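(* For every positive integer $n$ and all trees $T_0, T_1, \ldots, T_{n-1}$, we have $$\mathrm{capt}(T_0 \square T_1 \square \cdots \square T_{n-1}) \le \left( \sum_{i=0}^{n-1} \mathrm{rad}(T_i) \right)\lceil \log_2 n\rceil - \left\lfloor \frac{n-1}{2} \right\rfloor + 1.$$
   Context: Cops and Robbers is played on a finite reflexive graph (every vertex carries a loop, so a player may pass). The cops first choose starting vertices (turn 0), then the robber chooses a starting vertex; afterwards players alternate, the cops moving first: each cop moves to a neighbouring vertex or stays, then the robber moves to a neighbouring vertex or stays. A round is a cop move together with the subsequent robber move. The cops win when some cop occupies the same vertex as the robber. The cop number $c(G)$ is the minimum number of cops having a winning strategy; $\mathrm{capt}(G)$ is the minimum, over strategies of $c(G)$ cops, of the number of rounds (not counting round 0) needed to capture the robber, assuming the robber plays to delay capture as long as possible. The Cartesian product $G \square H$ has vertex set $V(G)\times V(H)$, with $(u,v)$ adjacent to $(u',v')$ iff either $u=u'$ and $vv' \in E(H)$, or $v=v'$ and $uu'\in E(G)$. The radius $\mathrm{rad}(G)$ is the minimum over vertices $u$ of the maximum distance from $u$ to another vertex. The cop number of a Cartesian product of $n$ (nontrivial) trees is $\lceil (n+1)/2\rceil$.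
   Formalization: All trees are assumed to have at least two vertices (for five one-vertex trees the bound would be −1), and for n = 1 the tree is assumed to have radius at most 1, since otherwise the bound is 1 while the capture time is at least 2. *)

(* Defs.v *)
From mathcomp Require Import all_boot.
From mathcomp Require Import boolp.

Set Implicit Arguments.
Unset Strict Implicit.
Unset Printing Implicit Defensive.

(* Finite simple graphs. Loops are not recorded in [adj]; the reflexive      *)
(* convention of the game (players may pass) is built into [step].           *)
Record sgraph := SGraph {
  vertex :> finType;
  adj : rel vertex;
  adj_sym : symmetric adj;
  adj_irr : irreflexive adj
}.
Arguments adj {s} _ _.

Definition is_connected (G : sgraph) : Prop :=
  0 < #|G| /\ forall x y : G, connect adj x y.

(* [ucycle] admits sequences of size at most 2, which are not graph cycles. *)
Definition is_acyclic (G : sgraph) : Prop :=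
  forall c : seq G, 2 < size c -> ~ ucycle adj c.

Definition is_tree (G : sgraph) : Prop := is_connected G /\ is_acyclic G.

(* A shortest path has fewer than #|G| edges, so in a connected graph this   *)
(* is the usual distance; #|G| is the value when y is not reachable from x.  *)
Definition graph_dist (G : sgraph) (x y : G) : nat :=
  \big[minn/#|G|]_(k < #|G| |
      [exists p : k.-tuple G, path adj x p && (last x p == y)]) k.

Definition ecc (G : sgraph) (x : G) : nat := \max_(y : G) graph_dist x y.

(* #|G| is never smaller than an eccentricity. *)
Definition radius (G : sgraph) : nat := \big[minn/#|G|]_(x : G) ecc x.

Section CartesianProduct.
Variables G H : sgraph.

Definition cart_adj : rel (G * H) := fun x y =>
  (x.1 == y.1) && adj x.2 y.2 || (x.2 == y.2) && adj x.1 y.1.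

Fact cart_adj_sym : symmetric cart_adj.
Proof.
by move=> x y; rewrite /cart_adj !(eq_sym x.1) !(eq_sym x.2) !(adj_sym x.1)
  !(adj_sym x.2).
Qed.

Fact cart_adj_irr : irreflexive cart_adj.
Proof. by move=> x; rewrite /cart_adj !adj_irr !andbF. Qed.

Definition cart : sgraph := SGraph cart_adj_sym cart_adj_irr.
End CartesianProduct.

(* T 0 [] T 1 [] ... [] T m, with m.+1 factors, associated to the left. *)
Fixpoint cart_upto (T : nat -> sgraph) (m : nat) : sgraph :=
  if m is m'.+1 then cart (cart_upto T m') (T m) else T 0.

Section Game.
Variable G : sgraph.

Definition step : rel G := fun x y => (x == y) || adj x y.

(* A play of the robber: r 0 is the starting vertex, r t the position at the *)
(* end of round t.                                                           *)
Definition walk (r : nat -> G) : Prop := forall t, step (r t) (r t.+1).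

(* A strategy of k cops maps the list of the past positions of the robber to *)
(* the positions of the cops after their next move. Since [mkseq r t] is     *)
(* [:: r 0; ...; r t.-1], [sigma [::]] is the initial placement, chosen      *)
(* before r 0, and [sigma (mkseq r t)] is the position after the cop move of *)
(* round t, chosen before r t.                                               *)
Definition strategy (k : nat) := seq G -> 'I_k -> G.

Section Strategy.
Variables (k : nat) (sigma : strategy k).

Definition legal : Prop := forall r, walk r ->
  forall t i, step (sigma (mkseq r t) i) (sigma (mkseq r t.+1) i).

(* The robber, standing on r t.-1, is caught by the cop move of round t, or  *)
(* moves onto a cop in round t.                                              *)
Definition caught (r : nat -> G) (t : nat) : Prop := exists i,
  sigma (mkseq r t) i = r t \/ 0 < t /\ sigma (mkseq r t) i = r t.-1.

Definition winning : Prop :=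
  legal /\ forall r, walk r -> exists t, caught r t.

Definition winning_within (t : nat) : Prop :=
  legal /\ forall r, walk r -> exists2 s, s <= t & caught r s.

Lemma eq_caught (r1 r2 : nat -> G) t :
  mkseq r1 t.+1 = mkseq r2 t.+1 -> caught r1 t -> caught r2 t.
Proof.
move=> E.
have En s : s <= t -> r1 s = r2 s.
  move=> st; have := congr1 (fun q => nth (r1 0) q s) E.
  by rewrite !nth_mkseq.
have Et : mkseq r1 t = mkseq r2 t.
  move: E; rewrite /mkseq -addn1 iotaD !map_cat => /eqP.
  by rewrite eqseq_cat ?size_map // => /andP[/eqP].
by case=> i; rewrite Et !En ?leq_pred // => H; exists i.
Qed.

(* Koenig's lemma: the duration of a winning strategy is bounded. *)
Lemma winning_bounded : winning -> exists t, winning_within t.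
Proof.
case=> leg win; apply: contrapT => nbd.
pose P h := forall t, exists2 r, walk r &
  mkseq r (size h) = h /\ forall s, s <= t -> ~ caught r s.
have P0 : P [::].
  move=> t; apply: contrapT => no; apply: nbd; exists t; split=> // r wr.
  apply: contrapT => nr; apply: no; exists r => //; split=> // s st cs.
  by apply: nr; exists s.
have PS h : P h -> exists v, P (rcons h v).
  move=> Ph; apply: contrapT => no.
  have bnd v : exists t, ~ (exists2 r, walk r &
      mkseq r (size (rcons h v)) = rcons h v /\
      forall s, s <= t -> ~ caught r s).
    apply: contrapT => nov; apply: no; exists v => t; apply: contrapT => nt.
    by apply: nov; exists t.
  have [b bP] := choice bnd.
  have [r wr [rh nc]] := Ph (\max_v b v).
  apply: (bP (r (size h))); exists r => //; split.
    rewrite size_rcons /mkseq -addn1 iotaD map_cat cats1 add0n.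
    by congr rcons.
  by move=> s sb; apply: nc; apply: leq_trans sb (leq_bigmax _).
have PS' h : exists v, P h -> P (rcons h v).
  have [/PS[v Pv]|nP] := pselect (P h); first by exists v.
  by have [r _ _] := P0 0; exists (r 0) => /nP.
have [f fP] := choice PS'.
pose h n := iter n (fun q => rcons q (f q)) [::].
pose r n := f (h n).
have hr n : mkseq r n = h n.
  elim: n => // n IH.
  by rewrite /h iterS -/(h n) -IH /mkseq -addn1 iotaD map_cat cats1 add0n
    /r -IH.
have Ph n : P (h n) by elim: n => //= n IH; apply: fP.
have wr : walk r.
  move=> t; have [r' wr' [E _]] := Ph t.+2 0.
  have En s : s < t.+2 -> r' s = r s.
    move=> st; move: E; rewrite -hr size_mkseq => E.
    by have := congr1 (fun q => nth (r 0) q s) E; rewrite !nth_mkseq.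
  by rewrite -!En.
have [t ct] := win r wr.
have [r' _ [E nc]] := Ph t.+1 t.
apply: (nc t) => //; apply: eq_caught ct.
by move: E; rewrite -hr size_mkseq => ->.
Qed.
End Strategy.

Lemma cop_number_ex :
  exists k, `[< exists sigma : strategy k, winning sigma >].
Proof.
exists #|G|; apply/asboolP; exists (fun _ => enum_val); split=> [r _ t i|r _].
  by rewrite /step eqxx.
by exists 0, (enum_rank (r 0)); left; rewrite enum_rankK.
Qed.

Definition cop_number : nat := ex_minn cop_number_ex.

Lemma capt_ex : exists t,
  `[< exists sigma : strategy cop_number, winning_within sigma t >].
Proof.
rewrite /cop_number; case: ex_minnP => k /asboolP[sigma ws] _.
by have [t wt] := winning_bounded ws; exists t; apply/asboolP; exists sigma.
Qed.

Definition capt : nat := ex_minn capt_ex.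
End Game.

(* Main.v *)
Require Import Defs.
From mathcomp Require Import all_boot all_order all_algebra.
From mathcomp Require Import boolp zify.

Set Implicit Arguments.
Unset Strict Implicit.
Unset Printing Implicit Defensive.

(* At most n/2 cops never win: a cop guards at most two of n neighbours of    *)
(* the robber in distinct directions, and only one if it is adjacent to the   *)
(* robber.                                                                    *)
(* For the upper bound all cops start at the centre. The coordinates are      *)
(* grouped in pairs, the leaves of a binary tree of height ceil(log_2 n) - 1, *)
(* with one cop per leaf (two cops on the last leaf if n is even; the last    *)
(* leaf is a single coordinate if n is odd). Going down from the root to its  *)
(* leaf, a cop corrects one by one the coordinates of the siblings of the     *)
(* nodes it visits: it always steps towards the robber in the first           *)
(* coordinate where they differ, so a corrected coordinate stays corrected.   *)
(* When the robber moves in a coordinate i, all the cops of the shallowest    *)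
(* unfinished node above i advance, hence each level of the tree lasts at     *)
(* most the sum of the radii. A cop that only differs from the robber in the  *)
(* two coordinates of its leaf reduces the larger of the two distances when   *)
(* their sum is odd and passes otherwise; the last leaf also makes progress   *)
(* when the robber passes, because its two cops keep distances of opposite    *)
(* parities. This endgame costs the sum of the radii once more, minus one     *)
(* round per leaf.                                                            *)

(** * Rooted trees *)

(** The bound comes from a potential, [teams_work]. In a tree rooted at its centre, a cop above the
    robber only has to descend, at most radius many times ([tree_rooting], [anc_adj]). With S the
    sum of the radii, each of the [h] levels of the tree of teams initially contributes at most S,
    and the endgame at most S plus one unit per leaf of two coordinates ([teams_work_center]). Every
    round without capture lowers the potential ([teams_round], resting on [prio_round], [team_round]
    and [total_work_decr]), yet while the robber is free it is at least 2 per leaf of two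
    coordinates and 1 per leaf of one ([teams_work_ge]).

    With M leaves this gives capture within (h+1)S - M + 1 rounds. Here M - 1 is the floor of
    (n-1)/2, and h + 1 is the ceiling of log2 n when n >= 2. The strategy uses floor(n/2) + 1 cops;
    by [cop_number_lower] this is the cop number, so the strategy bounds [capt]. *)

Lemma bigminn_leq (I : finType) (P : pred I) (F : I -> nat) d i :
  P i -> \big[minn/d]_(j | P j) F j <= F i.
Proof.
move=> Pi; have := mem_index_enum i.
elim: (index_enum I) => // j s IH; rewrite inE big_cons => /predU1P[<-|/IH le].
  by rewrite Pi geq_minl.
by case: ifP => // _; rewrite geq_min le orbT.
Qed.

Lemma bigminn_attained (I : finType) (P : pred I) (F : I -> nat) d :
  \big[minn/d]_(j | P j) F j = d \/
  exists2 i, P i & \big[minn/d]_(j | P j) F j = F i.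
Proof.
elim/big_ind: _ => [|x y|i Pi]; [by left | | by right; exists i].
case=> [->|[i Pi ->]]; case=> [->|[j Pj ->]].
- by left; rewrite minnn.
- by case: (leqP d (F j)) => _; [left | right; exists j].
- by case: (leqP (F i) d) => _; [right; exists i | left].
- by case: (leqP (F i) (F j)) => _; right; [exists i | exists j].
Qed.

Section Distance.
Variable G : sgraph.

Lemma graph_dist_leq_card (x y : G) : graph_dist x y <= #|G|.
Proof.
rewrite /graph_dist; elim/big_ind: _ => // [a b ? ?|i _]; last exact: ltnW.
by rewrite geq_min; apply/orP; left.
Qed.

Lemma graph_dist_path (x : G) p :
  path adj x p -> graph_dist x (last x p) <= size p.
Proof.
move=> px; have [lt|] := ltnP (size p) #|G|; last first.
  exact: leq_trans (graph_dist_leq_card _ _).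
apply: (@bigminn_leq _ _ (fun k : 'I_#|G| => k : nat) _ (Ordinal lt)).
by apply/existsP; exists (in_tuple p); rewrite /= px eqxx.
Qed.

Lemma graph_dist_attained (x y : G) : connect adj x y ->
  exists p, [/\ path adj x p, last x p = y & size p = graph_dist x y].
Proof.
case/connectP=> p0 p0x ->; case: (shortenP p0x) => p px up _ {p0 p0x}.
have lt : size p < #|G| by rewrite -[_.+1](card_uniqP up) max_card.
have := graph_dist_path px.
pose P (k : 'I_#|G|) := [exists q : k.-tuple G, path adj x q && (last x q == last x p)].
rewrite -[graph_dist _ _]/(\big[minn/#|G|]_(k < #|G| | P k) k).
have [->|[k /existsP[q /andP[qx /eqP qy]] ->] _] :=
  @bigminn_attained _ P (fun k : 'I_#|G| => k : nat) #|G|.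
  by rewrite leqNgt lt.
by exists q; rewrite size_tuple.
Qed.

Lemma graph_dist_eq0 (x y : G) : connect adj x y ->
  (graph_dist x y == 0) = (y == x).
Proof.
move=> xy; apply/eqP/eqP => [d0|->].
  have [p [_ e]] := graph_dist_attained xy.
  by rewrite d0 -e => /size0nil ->.
by apply/eqP; rewrite -leqn0; apply: (@graph_dist_path x [::]).
Qed.

Lemma graph_dist_pred (x y : G) : connect adj x y -> y != x ->
  exists y', adj y' y /\ graph_dist x y = (graph_dist x y').+1.
Proof.
move=> xy yx; have [p] := graph_dist_attained xy.
case/lastP: p => [[_ /= xy0]|p y0]; first by rewrite xy0 eqxx in yx.
rewrite rcons_path last_rcons size_rcons => -[/andP[px a0] e sp].
rewrite e in a0; exists (last x p); split=> //; apply/eqP.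
rewrite eqn_leq -{2}sp ltnS (graph_dist_path px) andbT.
have xy' : connect adj x (last x p) by apply/connectP; exists p.
have [q [qx ql <-]] := graph_dist_attained xy'.
have := @graph_dist_path x (rcons q y).
by rewrite rcons_path last_rcons size_rcons qx ql => ->.
Qed.

Lemma radius_attained : 0 < #|G| ->
  exists z : G, forall x, graph_dist z x <= radius G.
Proof.
case/card_gt0P=> x0 _; rewrite /radius.
have [->|[z _ ->]] := @bigminn_attained _ (fun _ : G => true) (@ecc G) #|G|.
  by exists x0 => x; apply: graph_dist_leq_card.
by exists z => x; apply: (leq_bigmax x).
Qed.

End Distance.

Record rooting (G : sgraph) := Rooting {
  rt_root : G;
  par : G -> G;
  dpt : G -> nat;
  par_root : par rt_root = rt_root;
  dpt_root : dpt rt_root = 0;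
  dpt_par : forall x, x != rt_root -> dpt x = (dpt (par x)).+1;
  par_adj : forall x, x != rt_root -> adj (par x) x;
  adj_par : forall x y, adj x y -> par x = y \/ par y = x
}.

(* In a tree, every edge joins a vertex to its parent: otherwise both ends   *)
(* are joined to the root without using the edge, which closes a cycle.      *)
Lemma tree_rooting (G : sgraph) : is_tree G ->
  exists rt : rooting G, forall x, dpt rt x <= radius G.
Proof.
case=> -[G0 conn] acyc; have [z zR] := radius_attained G0.
have ex x : exists y, if x == z then y = z
    else adj y x /\ graph_dist z x = (graph_dist z y).+1.
  have [_|xz] := eqVneq x z; first by exists z.
  exact: graph_dist_pred.
have [par parP] := choice ex.
have parz : par z = z by have := parP z; rewrite eqxx.
have parN x : x != z -> adj (par x) x /\ graph_dist z x = (graph_dist z (par x)).+1.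
  by move=> /negPf xz; move: (parP x); rewrite xz.
have dz : graph_dist z z = 0 by apply/eqP; rewrite graph_dist_eq0.
suff adjP x y : adj x y -> par x = y \/ par y = x.
  exists (@Rooting G z par (graph_dist z) parz dz
    (fun x xz => proj2 (parN x xz)) (fun x xz => proj1 (parN x xz)) adjP).
  exact: zR.
move=> axy; apply: contrapT => no.
have nxy : par x != y by apply/eqP => e; apply: no; left.
have nyx : par y != x by apply/eqP => e; apply: no; right.
pose e u v := adj u v && ~~ ((u == x) && (v == y) || (u == y) && (v == x)).
have esym : symmetric e.
  move=> u v; rewrite /e adj_sym; congr (_ && ~~ _).
  by rewrite orbC; congr (_ || _); rewrite andbC.
have cz v : connect e z v.
  elim: {v}(graph_dist z v) {-2}v (erefl (graph_dist z v)) => [|d IH] v.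
    by move/eqP; rewrite graph_dist_eq0 // => /eqP ->.
  move=> dv; have vz : v != z by apply/eqP => vz; rewrite vz dz in dv.
  have [av dv'] := parN v vz.
  apply: connect_trans (IH (par v) _) (connect1 _); first by move: dv; rewrite dv' => -[].
  rewrite /e av; apply/norP; split; apply/negP => /andP[/eqP e1 /eqP e2].
    by rewrite -e2 e1 eqxx in nyx.
  by rewrite -e2 e1 eqxx in nxy.
have: connect e x y by apply: connect_trans (cz y); rewrite (sym_connect_sym esym).
case/connectP=> p0 p0x; case: (shortenP p0x) => p px up _ py {p0 p0x}.
apply: (acyc (x :: p)).
  case: p px up py => [|a [|b p]] //=.
    by move=> _ _ E; move: axy; rewrite E adj_irr.
  by rewrite andbT => + _ E; rewrite -E /e !eqxx andbF.
rewrite /ucycle up andbT /= rcons_path -py adj_sym axy andbT.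
by apply: sub_path px => u v /andP[].
Qed.

Section RootedTree.
Variables (G : sgraph) (rt : rooting G).
Implicit Types x y : G.
Local Notation z := (rt_root rt).
Local Notation par := (par rt).
Local Notation dpt := (dpt rt).

Definition anc x y := fconnect par y x.

Lemma anc_refl x : anc x x. Proof. exact: connect0. Qed.

Lemma ancP x y : reflect (exists k, iter k par y = x) (anc x y).
Proof.
apply: (iffP idP) => [a|[k <-]]; last exact: fconnect_iter.
by exists (findex par y x); apply: iter_findex.
Qed.

Lemma dpt_eq0 x : (dpt x == 0) = (x == z).
Proof.
have [->|xz] := eqVneq x z; first by rewrite dpt_root.
by rewrite (dpt_par xz).
Qed.

Lemma dpt_iter k x : dpt (iter k par x) = dpt x - k.
Proof.
elim: k => [|k IH]; first by rewrite subn0.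
rewrite iterS subnS -IH; have [->|xz] := eqVneq (iter k par x) z.
  by rewrite par_root dpt_root.
by rewrite [in RHS](dpt_par xz).
Qed.

Lemma anc_root y : anc z y.
Proof. by apply/ancP; exists (dpt y); apply/eqP; rewrite -dpt_eq0 dpt_iter subnn. Qed.

Lemma anc_leq x y : anc x y -> dpt x <= dpt y.
Proof. by case/ancP=> k <-; rewrite dpt_iter leq_subr. Qed.

Lemma anc_iter x y : anc x y -> iter (dpt y - dpt x) par y = x.
Proof.
case/ancP=> k <-; rewrite dpt_iter.
have [le|lt] := leqP k (dpt y); first by congr iter; lia.
have iz j : dpt y <= j -> iter j par y = z.
  by move=> le; apply/eqP; rewrite -dpt_eq0 dpt_iter subn_eq0.
by rewrite !iz //; lia.
Qed.

(** A vertex has one ancestor per depth; this is what reduces the endgame to numbers. *)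
Lemma anc_eq x y : anc x y -> (x == y) = (dpt x == dpt y).
Proof.
move=> a; apply/eqP/eqP => [->//|e].
by have := anc_iter a; rewrite e subnn.
Qed.

Lemma adj_dpt x y : adj x y -> dpt y = (dpt x).+1 \/ dpt x = (dpt y).+1.
Proof.
have nz u v : adj u v -> par u = v -> u != z.
  move=> auv e; apply/eqP => uz; move: e auv; rewrite uz par_root => <-.
  by rewrite adj_irr.
move=> a; have [e|e] := adj_par rt a; [right|left].
  by rewrite (dpt_par (nz _ _ a e)) e.
by rewrite adj_sym in a; rewrite (dpt_par (nz _ _ a e)) e.
Qed.

(** The robber can leave the subtree of [x] only through [x] itself. *)
Lemma anc_adj x y y' : anc x y -> x != y -> adj y y' -> anc x y'.
Proof.
case/ancP=> -[/= ->|k e] xy a; first by rewrite eqxx in xy.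
apply/ancP; have [e'|e'] := adj_par rt a.
  by exists k; rewrite -e iterSr e'.
by exists k.+2; rewrite iterSr e'.
Qed.

(** The last branch goes up: it lets a cop that stood on the robber follow it to the parent. *)
Definition toward x y :=
  if x == y then x else if anc x y then iter (dpt y - dpt x).-1 par y else par x.

Lemma par_step x : step x (par x).
Proof.
rewrite /step; have [->|xz] := eqVneq x z; first by rewrite par_root eqxx.
by rewrite adj_sym par_adj // orbT.
Qed.

Lemma step_sym : symmetric (@step G).
Proof. by move=> x y; rewrite /step eq_sym adj_sym. Qed.

Section Toward.
Variables x y : G.
Hypotheses (xy : anc x y) (nxy : x != y).

Lemma anc_ltn : dpt x < dpt y.
Proof. by rewrite ltn_neqAle -anc_eq // nxy anc_leq. Qed.

Lemma par_toward : par (toward x y) = x.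
Proof.
rewrite /toward (negPf nxy) xy -iterS prednK; first exact: anc_iter.
by rewrite subn_gt0 anc_ltn.
Qed.

Lemma dpt_toward : dpt (toward x y) = (dpt x).+1.
Proof.
rewrite /toward (negPf nxy) xy dpt_iter; have := anc_ltn; lia.
Qed.

Lemma anc_toward : anc (toward x y) y.
Proof. by rewrite /toward (negPf nxy) xy; apply: fconnect_iter. Qed.

End Toward.

Lemma toward_step x y : step x (toward x y).
Proof.
have [e|nxy] := eqVneq x y; first by rewrite /toward e eqxx /step eqxx.
have [a|na] := boolP (anc x y).
  by rewrite step_sym -{2}(par_toward a nxy) par_step.
by rewrite /toward (negPf nxy) (negPf na) par_step.
Qed.

Lemma toward_adj x y : adj x y -> toward x y = y.
Proof.
move=> a; rewrite /toward; have [e|_] := eqVneq x y; first by rewrite e adj_irr in a.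
have [axy|na] := boolP (anc x y).
  have [->|e] := adj_dpt a; first by rewrite subSn // subnn.
  by have := anc_leq axy; rewrite e ltnn.
have [//|e] := adj_par rt a.
by case/negP: na; apply/ancP; exists 1.
Qed.

End RootedTree.

(* Vertices of the product are handled as sequences of coordinates indexed by *)
(* all of [nat]; the coordinates past the last factor stay at the root.       *)
Section Coordinates.
Variables (T : nat -> sgraph) (rt : forall i, rooting (T i)).

Definition pos := forall i, T i.
Implicit Types f g : pos.

Definition center : pos := fun i => rt_root (rt i).

Fixpoint pos_of m : cart_upto T m -> pos :=
  if m is m'.+1 return cart_upto T m -> pos
  then fun x => dfwith (pos_of x.1) (x.2 : T m'.+1)
  else fun x => dfwith center (x : T 0).

Fixpoint of_pos m f : cart_upto T m :=
  if m is m'.+1 return cart_upto T m then (of_pos m' f, f m'.+1) else f 0.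

Lemma pos_of_center m (x : cart_upto T m) i : m < i -> pos_of x i = center i.
Proof.
elim: m x => [|m IH] x lt /=; first by rewrite dfwith_out //; lia.
by rewrite dfwith_out ?IH //; lia.
Qed.

Lemma eq_of_pos m f g :
  (forall i, i <= m -> f i = g i) -> of_pos m f = of_pos m g.
Proof.
elim: m => [|m IH] fg /=; first by rewrite fg.
by rewrite fg // IH // => i im; apply: fg; lia.
Qed.

Lemma pos_ofK m : cancel (@pos_of m) (of_pos m).
Proof.
elim: m => [|m IH] x /=; first by rewrite dfwith_in.
rewrite dfwith_in; case: x => x1 x2 /=; congr pair.
by rewrite -[RHS]IH; apply: eq_of_pos => i im; rewrite dfwith_out //; lia.
Qed.

Lemma of_posK m f i : i <= m -> pos_of (of_pos m f) i = f i.
Proof.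
elim: m => [|m IH] /=; first by rewrite leqn0 => /eqP->; rewrite dfwith_in.
rewrite leq_eqVlt => /predU1P[->|lt]; first by rewrite dfwith_in.
by rewrite dfwith_out ?IH //; lia.
Qed.

Definition pos_step n f g := g = f \/
  exists i, [/\ i < n, adj (f i) (g i) & forall j, j != i -> g j = f j].

Lemma of_pos_step m f g :
  pos_step m.+1 f g -> step (of_pos m f) (of_pos m g).
Proof.
rewrite /step; case=> [->|[i [im a out]]]; first by rewrite eqxx.
apply/orP; right.
have eqk k : k < i -> of_pos k g = of_pos k f.
  elim: k => [|k IH] lt /=; first by rewrite out //; lia.
  by rewrite IH ?out //; lia.
elim: m im => [|m IH] im /=; first by move: a; have -> : i = 0 by lia.
rewrite /cart_adj /=; have [e|ne] := eqVneq i m.+1.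
  by rewrite -e a andbT eqk ?eqxx //; lia.
rewrite out 1?eq_sym // eqxx /= IH ?orbT //; lia.
Qed.

Lemma pos_of_step m (x y : cart_upto T m) :
  step x y -> pos_step m.+1 (pos_of x) (pos_of y).
Proof.
rewrite /step => /orP[/eqP->|]; first by left.
move=> a; right; elim: m x y a => [|m IH] /= x y a.
  exists 0; rewrite !dfwith_in; split=> // j j0.
  by rewrite !dfwith_out 1?eq_sym.
case: x y a => [x1 x2] [y1 y2]; rewrite /cart_adj /=.
case/orP=> /andP[/eqP <- a].
  exists m.+1; rewrite !dfwith_in; split=> // j j0.
  by rewrite !dfwith_out 1?eq_sym.
have [i [im ai out]] := IH _ _ a; exists i; split; first exact: leqW.
  by rewrite !dfwith_out //; lia.
move=> j ji; have [->|jm] := eqVneq j m.+1; first by rewrite !dfwith_in.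
by rewrite !dfwith_out 1?eq_sym // out.
Qed.

Definition move_toward f i g : pos := dfwith f (toward (rt i) (f i) (g i)).

Lemma move_toward_step n f i g : i < n -> pos_step n f (move_toward f i g).
Proof.
move=> lt; have := toward_step (rt i) (f i) (g i); rewrite /step.
case/orP=> [/eqP e|a]; [left|right].
  apply: functional_extensionality_dep => j; rewrite /move_toward.
  by have [<-|ne] := eqVneq i j; rewrite ?dfwith_in ?dfwith_out.
exists i; rewrite /move_toward dfwith_in; split=> // j ne.
by rewrite dfwith_out 1?eq_sym.
Qed.

End Coordinates.

(** * Fewer cops lose *)

Lemma ex_adj (G : sgraph) (x : G) : is_connected G -> 1 < #|G| -> exists y, adj x y.
Proof.
case=> _ conn; rewrite (cardD1 x) inE ltnS => /card_gt0P[y].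
rewrite !inE andbT => yx.
have /connectP[[|a p] /= px e] := conn x y; first by rewrite e eqxx in yx.
by exists a; case/andP: px.
Qed.

Section LowerBound.
Variables (T : nat -> sgraph) (rt : forall i, rooting (T i)).
Hypothesis ex_nbr : forall i (x : T i), exists y, adj x y.

(* [f] is the robber, [g] a cop guarding its neighbour in direction [j]. *)
Lemma guard_directions n (f g : pos T) j (u : T j) :
    adj (f j) u -> (exists l, g l != f l) -> pos_step n g (dfwith f u) ->
  g j != f j /\ exists l, forall j', g j' != f j' -> j' = j \/ j' = l.
Proof.
move=> fu [l0 gl0] st.
have uf : u != f j by apply/eqP => e; rewrite e adj_irr in fu.
case: st => [e|[l [_ al out]]].
  rewrite -e dfwith_in; split=> //; exists j => j' nj; left; apply/eqP.
  by apply: contraNT nj => nj; rewrite dfwith_out // eq_sym.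
have [ejl|njl] := eqVneq j l.
  have gf j' : g j' != f j' -> j' = j.
    move=> nj; apply/eqP; apply: contraNT nj => nj.
    by rewrite -out -?ejl // dfwith_out // eq_sym.
  by split; [rewrite -(gf l0) | exists j => j' /gf; left].
rewrite -(out j njl) dfwith_in; split=> //; exists l => j' nj.
have [->|j'l] := eqVneq j' l; [by right | left; apply/eqP].
by apply: contraNT nj => nj; rewrite -out // dfwith_out // eq_sym.
Qed.

(** If every neighbour of the robber were guarded, each of the [m.+1] directions could be assigned
    to a cop guarding it. A cop receives at most two directions, and an adjacent one at most one, so
    fewer than [k.*2] directions would be covered. *)
Lemma robber_escape m k (c : 'I_k -> cart_upto T m) (v : cart_upto T m) :
    (forall i, c i != v) -> k.*2 <= m.+1 ->
  exists v', step v v' /\ forall i, ~~ step (c i) v'.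
Proof.
move=> cv km; have [[i0 ci0]|stay] := pselect (exists i, step (c i) v); last first.
  exists v; rewrite {1}/step eqxx; split=> // i; apply/negP => s.
  by apply: stay; exists i.
pose cc i := pos_of rt (c i); pose f := pos_of rt v.
have diff i : exists l, cc i l != f l.
  apply: contrapT => no; have /eqP[] := cv i.
  rewrite -(pos_ofK rt (c i)) -(pos_ofK rt v); congr of_pos.
  apply: functional_extensionality_dep => l; apply/eqP/negPn/negP => ne.
  by apply: no; exists l.
pose D i := [set j : 'I_m.+1 | cc i j != f j].
apply: contrapT => no.
have cov (j : 'I_m.+1) : exists i, (j \in D i) && (#|D i| <= 2).
  have [u fu] := ex_nbr (f j).
  have st : pos_step m.+1 f (dfwith f u).
    right; exists j; rewrite dfwith_in; split=> // l lj.
    by rewrite dfwith_out // eq_sym.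
  have := of_pos_step st; rewrite pos_ofK => sv.
  have [i si] : exists i, step (c i) (of_pos m (dfwith f u)).
    apply: contrapT => ns; apply: no; exists (of_pos m (dfwith f u)); split=> // i.
    by apply/negP => s; apply: ns; exists i.
  have ccs : pos_step m.+1 (cc i) (dfwith f u).
    have := pos_of_step rt si; congr pos_step.
    apply: functional_extensionality_dep => l.
    have [lm|lm] := ltnP l m.+1; last first.
      rewrite pos_of_center // dfwith_out; last by case: j {fu st sv si u} => j /=; lia.
      by rewrite /f pos_of_center.
    by rewrite of_posK.
  have [gj [l gl]] := guard_directions fu (diff i) ccs.
  exists i; rewrite inE gj /=.
  apply: (@leq_trans #|[set j; inord l]|); last by rewrite cards2; case: (_ != _).
  apply: subset_leq_card; apply/subsetP => j'; rewrite !inE => /gl[/val_inj->|e].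
    by rewrite eqxx.
  by apply/orP; right; rewrite -e inord_val.
have D1 : #|D i0| <= 1.
  have := pos_of_step rt ci0; rewrite -/(cc i0) -/f => -[e|[l [lm _ out]]].
    by have [l] := diff i0; rewrite e eqxx.
  rewrite -(cards1 (Ordinal lm)); apply: subset_leq_card; apply/subsetP => j.
  rewrite !inE; apply: contraNT => nj.
  by rewrite -[cc i0 j]out // -(inj_eq val_inj).
have [h hP] := choice cov.
have := sum1_card (fun _ : 'I_m.+1 => true); rewrite eq_cardT // size_enum_ord.
rewrite (partition_big h xpredT) //= => e.
have le2 i : \sum_(j < m.+1 | h j == i) 1 <= #|D i|.
  rewrite sum1_card; apply: subset_leq_card; apply/subsetP => j hj.
  by have <- : h j = i by [apply/eqP; exact: hj]; case/andP: (hP j).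
have le2' i : \sum_(j < m.+1 | h j == i) 1 <= 2.
  have [[j /eqP <-]|nh] := pselect (exists j, h j == i).
    by rewrite (leq_trans (le2 _)) //; case/andP: (hP j).
  by rewrite big1 // => j hj; case: nh; exists j.
suff: m.+1 < k.*2 by lia.
rewrite -e (bigD1 i0) //=; apply: (@leq_trans (2 + \sum_(i < k | i != i0) 2)).
  by rewrite -addSn leq_add ?leq_sum // ltnS (leq_trans (le2 i0)).
have : \sum_(i < k) 2 = k.*2 by rewrite sum_nat_const card_ord muln2.
by rewrite (bigD1 i0) //= => ->.
Qed.

Lemma card_cart_upto m : (forall i, 1 < #|T i|) -> m.+1 < #|cart_upto T m|.
Proof.
move=> T2; elim: m => [|m IH] /=; first exact: T2.
by rewrite card_prod; have := T2 m.+1; nia.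
Qed.

Lemma cop_number_lower m : (forall i, 1 < #|T i|) -> m.+1./2 < cop_number (cart_upto T m).
Proof.
move=> T2; rewrite /cop_number; case: ex_minnP => k /asboolP[sigma [leg win]] _.
rewrite ltnNge; apply/negP => km; have {km} km : k.*2 <= m.+1 by lia.
pose G := cart_upto T m.
have [v0 v0P] : exists v0 : G, forall i, sigma [::] i != v0.
  apply: contrapT => no; have := card_cart_upto m T2.
  apply/negP; rewrite -leqNgt.
  apply: (@leq_trans #|'I_k|); last by rewrite card_ord; lia.
  apply: leq_trans (leq_image_card (sigma [::]) 'I_k).
  apply: subset_leq_card; apply/subsetP => v _; apply/imageP; apply: contrapT => nv.
  by apply: no; exists v => i; apply/eqP => e; apply: nv; exists i.
(* The robber answers the cops' move, which depends only on its own past; iterating [next] builds an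
   evading walk from the free vertex [v0]. *)
have nextP (h : seq G) : exists v, step (last v0 h) v /\
    ((forall i, sigma h i != last v0 h) -> forall i, ~~ step (sigma h i) v).
  have [cv|ncv] := pselect (forall i, sigma h i != last v0 h); last first.
    by exists (last v0 h); rewrite {1}/step eqxx.
  by have [v [sv nv]] := robber_escape cv km; exists v.
have [next nextS] := choice nextP.
pose h t := iter t (fun q => rcons q (next q)) [::].
pose r t := next (h t).
have hr t : mkseq r t = h t.
  elim: t => // t IH.
  by rewrite /h iterS -/(h t) -IH /mkseq -addn1 iotaD map_cat cats1 add0n /r -IH.
have wr : walk r.
  move=> t; have [+ _] := nextS (h t.+1).
  by rewrite {1}/h iterS last_rcons.
have free t i : ~~ step (sigma (h t) i) (r t).
  elim: t i => [|t IH] i; first by have [_] := nextS [::]; apply.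
  have [_] := nextS (h t.+1); apply=> j; rewrite {2}/h iterS last_rcons -/(h t) -/(r t).
  apply: contraNneq (IH j) => <-; rewrite -!hr; exact: leg.
have [t [i]] := win r wr; rewrite hr.
have ss := free t i; case=> [e|[t0 e]].
  by rewrite e /step eqxx in ss.
case: t t0 e ss => // t _ e _; have := leg r wr t i; rewrite !hr e /=.
by apply/negP.
Qed.
End LowerBound.

(** * A cop correcting its coordinates in order of priority *)

Section Priority.
Variables (T : nat -> sgraph) (rt : forall i, rooting (T i)) (R : nat -> nat).
Hypothesis dpt_leq : forall i x, dpt (rt i) x <= R i.
Variables (n : nat) (P : pred nat) (rk : nat -> nat).
Hypothesis rk_inj : forall i j, i < n -> j < n -> rk i = rk j -> i = j.
Implicit Types (b r : pos T) (i j : nat).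

Definition mismatch b r i := [&& i < n, P i & b i != r i].

Definition first_mismatch b r : option 'I_n :=
  [pick t : 'I_n | mismatch b r t &&
     [forall j : 'I_n, mismatch b r j ==> (rk t <= rk j)]].

Variant first_mismatch_spec b r : option 'I_n -> Prop :=
| FirstMismatch (t : 'I_n) of mismatch b r t &
    (forall j, mismatch b r j -> rk t <= rk j) : first_mismatch_spec b r (Some t)
| NoMismatch of (forall j, ~~ mismatch b r j) : first_mismatch_spec b r None.

Lemma first_mismatchP b r : first_mismatch_spec b r (first_mismatch b r).
Proof.
rewrite /first_mismatch; case: pickP => [t /andP[mt /forallP min]|no].
  constructor=> // j mj; have jn : j < n by case/andP: mj.
  by have /implyP := min (Ordinal jn); apply.
constructor=> j; apply/negP => mj; have jn : j < n by case/andP: mj.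
pose m (i : 'I_n) := mismatch b r i.
have [t mt min] : exists2 t, m t & forall i : 'I_n, m i -> rk t <= rk i.
  by case: (@arg_minnP _ (Ordinal jn) m (fun i : 'I_n => rk i) mj) => t; exists t.
have /negP := negbT (no t); apply; apply/andP; split=> //; apply/forallP => i; apply/implyP.
exact: min.
Qed.

Definition fixed_below b r i :=
  [forall j : 'I_n, P j && (rk j <= rk i) ==> (b j == r j)].

Lemma fixed_belowP b r i :
  reflect (forall j, mismatch b r j -> rk i < rk j) (fixed_below b r i).
Proof.
apply: (iffP forallP) => [fb j /and3P[jn Pj]|fb j].
  apply: contraNltn => le; have := fb (Ordinal jn); by rewrite /= Pj le.
apply/implyP => /andP[Pj le]; apply: contraLR le => ne; rewrite -ltnNge.
by apply: fb; rewrite /mismatch ltn_ord Pj.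
Qed.

Lemma fixed_belowPn b r i :
  ~~ fixed_below b r i -> exists2 j, mismatch b r j & rk j <= rk i.
Proof.
move=> /fixed_belowP nfb; apply: contrapT => no; apply: nfb => j mj.
by rewrite ltnNge; apply/negP => le; apply: no; exists j.
Qed.

Lemma fixed_below_leq b r i j : rk i <= rk j -> fixed_below b r j -> fixed_below b r i.
Proof.
move=> le /fixed_belowP fb; apply/fixed_belowP => k /fb.
exact: leq_ltn_trans.
Qed.

Lemma fixed_below_mismatch b r i j :
  fixed_below b r i -> j < n -> P j -> rk j <= rk i -> b j = r j.
Proof.
move=> /fixed_belowP fb jn Pj le; apply/eqP; apply: contraLR le => ne.
by rewrite -ltnNge fb // /mismatch jn Pj.
Qed.

(** Until [i] is settled the cop only descends there, and at most to depth [R i]; once settled it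
    merely copies the robber, possibly upwards, and nothing more is charged. *)
Definition work b r i := if fixed_below b r i then 0 else R i - dpt (rt i) (b i).

(** Coordinates after the first mismatch wait at the root, which is above the robber wherever it
    goes. *)
Definition prio_inv b r := forall i, i < n -> P i -> anc (rt i) (b i) (r i) /\
  forall j, mismatch b r j -> rk j < rk i -> b i = rt_root (rt i).

Definition prio_move b r :=
  if first_mismatch b r is Some t then move_toward rt b t r else b.

Lemma move_toward_in b r i : move_toward rt b i r i = toward (rt i) (b i) (r i).
Proof. by rewrite /move_toward dfwith_in. Qed.

Lemma move_toward_out b r i j : j != i -> move_toward rt b i r j = b j.
Proof. by move=> ne; rewrite /move_toward dfwith_out // eq_sym. Qed.

Section Round.
Variables b r b' r' : pos T.
Hypotheses (inv : prio_inv b r) (rr' : pos_step n r r').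
Hypothesis b'E : forall i, P i -> b' i = prio_move b r' i.

Lemma pos_stepN i : r' i != r i -> i < n.
Proof.
case: rr' => [->|[k [kn _ out]]]; first by rewrite eqxx.
by have [->|/out->] := eqVneq i k; rewrite // eqxx.
Qed.

(** The cop stands on the robber in [i] and in all earlier coordinates, so the move makes [i] its
    first mismatch and one step copies the move. *)
Lemma prio_follow i : P i -> r' i != r i -> fixed_below b r i ->
  (forall j, mismatch b' r' j = mismatch b r j) /\
  (forall j, j != i -> P j -> b' j = b j).
Proof.
move=> Pi ri fb; have i_n := pos_stepN ri.
have bi : b i = r i.
  by apply/eqP; apply: contraT => ne; have := fixed_belowP _ _ _ fb i;
    rewrite /mismatch i_n Pi ne ltnn => /(_ isT).
have [ai out] : adj (r i) (r' i) /\ forall j, j != i -> r' j = r j.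
  case: rr' ri => [->|[k [_ a out]]]; first by rewrite eqxx.
  by have [->|/out->] := eqVneq i k; rewrite ?eqxx.
have mi : mismatch b r' i by rewrite /mismatch i_n Pi bi eq_sym.
have b'Ei : forall j, P j -> b' j = move_toward rt b i r' j.
  move=> j Pj; rewrite b'E // /prio_move.
  case: first_mismatchP => [t mt min|/(_ i)]; last by rewrite mi.
  have [<- //|ti] := eqVneq (t : nat) i; have := min i mi.
  rewrite leqNgt; have -> // : rk i < rk t.
  by apply: (fixed_belowP _ _ _ fb); rewrite /mismatch -out.
split=> [j|j ji Pj]; last by rewrite b'Ei // move_toward_out.
rewrite /mismatch; case: (ltnP j n) => //= jn; case Pj: (P j) => //=.
rewrite b'Ei //; have [->|ji] := eqVneq j i.
  by rewrite move_toward_in bi toward_adj // !eqxx.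
by rewrite move_toward_out // out.
Qed.

Hypothesis unsettled : forall i, P i -> r' i != r i -> ~~ fixed_below b r i.

Lemma fixed_below_mono i : fixed_below b r i -> fixed_below b r' i.
Proof.
move=> fb; apply/fixed_belowP => j /and3P[jn Pj]; apply: contraNltn => le.
have [->|/(unsettled Pj)] := eqVneq (r' j) (r j); last first.
  by rewrite (fixed_below_leq le fb).
by rewrite (fixed_below_mismatch fb).
Qed.

(** The robber could slip above the cop only from the cop's own vertex; but if they agree in the
    unsettled [i], an earlier mismatch keeps the cop at the root there. *)
Lemma unsettled_anc i : i < n -> P i -> anc (rt i) (b i) (r' i).
Proof.
move=> i_n Pi; have [a rtP] := inv i_n Pi.
have [-> //|ri] := eqVneq (r' i) (r i).
have ai : adj (r i) (r' i).
  case: rr' ri => [->|[k [_ a' out]]]; first by rewrite eqxx.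
  by have [->|/out->] := eqVneq i k; rewrite ?eqxx.
have [bi|bi] := eqVneq (b i) (r i); last exact: anc_adj ai.
have [j mj le] := fixed_belowPn (unsettled Pi ri).
rewrite (rtP j) ?anc_root // ltn_neqAle le andbT.
have jn : j < n by case/andP: mj.
by apply: contraTneq mj => /(rk_inj jn i_n) ->; rewrite /mismatch bi eqxx !andbF.
Qed.

Lemma mismatch_unsettled i : mismatch b r' i -> ~~ fixed_below b r i.
Proof.
move=> /and3P[i_n Pi ne]; apply: contraTN ne => /fixed_below_mono fb.
by rewrite (fixed_below_mismatch fb) ?eqxx.
Qed.

Lemma prio_advance (t : 'I_n) : first_mismatch b r' = Some t ->
  dpt (rt t) (b' t) = (dpt (rt t) (b t)).+1 /\ anc (rt t) (b' t) (r' t).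
Proof.
move=> ft; have : first_mismatch_spec b r' (Some t) by rewrite -ft; apply: first_mismatchP.
move=> spec; inversion spec as [t' mt _ e|]; subst t'; have /and3P[_ Pt ne] := mt.
rewrite b'E // /prio_move ft move_toward_in.
by split; [apply: dpt_toward | apply: anc_toward] => //; apply: unsettled_anc.
Qed.

End Round.

(** The witness is the first mismatch: there the cop is a strict ancestor of the robber, so its
    depth is less than [R]. *)
Lemma ex_work b r (Q : pred nat) : prio_inv b r ->
    (exists i, [/\ i < n, P i, Q i & ~~ fixed_below b r i]) ->
    (forall i, i < n -> P i -> ~~ fixed_below b r i -> Q i \/
       forall j, j < n -> P j -> Q j -> rk j < rk i) ->
  exists i, [/\ i < n, P i, Q i & 0 < work b r i].
Proof.
move=> inv [i [i_n Pi Qi nfb]] low; have [j mj le] := fixed_belowPn nfb.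
case: (first_mismatchP b r) => [t mt min|/(_ j)]; last by rewrite mj.
have nfbt : ~~ fixed_below b r t.
  by apply/negP => /fixed_belowP /(_ _ mt); rewrite ltnn.
have /and3P[tn Pt ne] := mt; exists t; split=> //.
  have [//|lt] := low t tn Pt nfbt; have := lt i i_n Pi Qi.
  by rewrite ltnNge (leq_trans (min j mj) le).
have [a _] := inv t tn Pt; rewrite /work (negPf nfbt) subn_gt0.
exact: leq_trans (anc_ltn a ne) (dpt_leq _).
Qed.

(* Once the first mismatch [t] of the robber's new position is fixed, the    *)
(* coordinates of smaller rank stay matched and those of larger rank, still  *)
(* at the root, keep the cop above the robber.                               *)
Lemma prio_round b r b' r' : prio_inv b r -> pos_step n r r' ->
    (forall i, P i -> b' i = prio_move b r' i) ->
  [/\ prio_inv b' r', forall i, P i -> i < n -> work b' r' i <= work b r i &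
      forall Q : pred nat,
        (forall i, P i -> r' i != r i -> ~~ fixed_below b r i) ->
        (exists i, [/\ i < n, P i, Q i & ~~ fixed_below b r i]) ->
        (forall i, i < n -> P i -> ~~ fixed_below b r i -> Q i \/
           forall j, j < n -> P j -> Q j -> rk j < rk i) ->
        exists i, [/\ i < n, P i, Q i & work b' r' i < work b r i]].
Proof.
move=> inv rr' b'E.
(* Either the robber moves in a settled coordinate and is copied, or the cop is free to descend in
   its first mismatch. *)
have [[i [Pi ri fb]]|nsettled] :=
    pselect (exists i, [/\ P i, r' i != r i & fixed_below b r i]).
  have i_n := pos_stepN rr' ri; have [mE out] := prio_follow rr' b'E Pi ri fb.
  have fbE j : fixed_below b' r' j = fixed_below b r j.
    by apply/fixed_belowP/fixed_belowP => h k; have := h k; rewrite mE.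
  have rE j : j != i -> r' j = r j.
    case: rr' ri => [->|[k [_ _ outk]]]; first by rewrite eqxx.
    by have [e _ ji|/outk->] := eqVneq i k; [apply: outk; rewrite -e | rewrite eqxx].
  split=> [j jn Pj|j Pj jn|Q uns].
  - have [->|ji] := eqVneq j i; last first.
      have [a h] := inv j jn Pj; rewrite out // rE //; split=> // k.
      by rewrite mE; apply: h.
    have := mE i; rewrite /mismatch (fixed_below_mismatch fb) // eqxx i_n Pi /=.
    move=> /negbFE /eqP b'i; rewrite b'i; split=> [|k]; first exact: anc_refl.
    move=> mj; have {mj} mj : mismatch b r k by rewrite -mE.
    move=> lt.
    by have := ltn_trans lt (fixed_belowP _ _ _ fb k mj); rewrite ltnn.
  - rewrite /work fbE; have [->|ji] := eqVneq j i; first by rewrite fb.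
    by rewrite out.
  - by have := uns i Pi ri; rewrite fb.
have uns i : P i -> r' i != r i -> ~~ fixed_below b r i.
  by move=> Pi ri; apply/negP => fb; apply: nsettled; exists i.
have mono i (fb : fixed_below b r i) := fixed_below_mono uns fb.
case E : (first_mismatch b r') (first_mismatchP b r') => [t|] spec; last first.
  inversion spec as [|no e]; subst.
  have bE i : P i -> b' i = b i by move=> Pi; rewrite b'E // /prio_move E.
  have no' j : ~~ mismatch b' r' j.
    apply/negP => /and3P[jn Pj]; rewrite bE // => ne; have := no j.
    by rewrite /mismatch jn Pj ne.
  have fb i : fixed_below b' r' i.
    by apply/fixed_belowP => j mj; have := no' j; rewrite mj.
  split=> [i i_n Pi|i Pi i_n|Q _ [i [i_n Pi Qi nfb]] low].
  - rewrite bE //; split; first exact: (unsettled_anc inv rr' uns).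
    by move=> j mj; have := no' j; rewrite mj.
  - by rewrite /work fb.
  - have [t [tn Pt Qt wt]] := ex_work inv (ex_intro _ i (And4 i_n Pi Qi nfb)) low.
    by exists t; split=> //; rewrite {1}/work fb.
inversion spec as [t0 mt min e|]; subst t0.
have [dt at_] := prio_advance inv rr' b'E uns E.
have /and3P[_ Pt _] := mt.
have bE i : i != t -> P i -> b' i = b i.
  by move=> it Pi; rewrite b'E // /prio_move E move_toward_out.
have mm j : mismatch b' r' j -> mismatch b r' j.
  have [-> //|jt] := eqVneq j t; move=> /and3P[jn Pj].
  by rewrite bE // /mismatch jn Pj.
have nfbt := mismatch_unsettled uns mt.
have fbE i : fixed_below b r i -> fixed_below b' r' i.
  by move=> /mono /fixed_belowP fb; apply/fixed_belowP => j /mm; apply: fb.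
have dptE i : P i -> dpt (rt i) (b i) <= dpt (rt i) (b' i).
  by move=> Pi; have [->|it] := eqVneq i t; rewrite ?dt ?bE.
split=> [i i_n Pi|i Pi i_n|Q _ ex low].
- split.
    have [->|it] := eqVneq i t; first exact: at_.
    by rewrite bE //; apply: (unsettled_anc inv rr' uns).
  move=> j /mm mj lt; have := leq_ltn_trans (min j mj) lt => {}lt.
  have it : i != t by apply: contraTneq lt => ->; rewrite ltnn.
  rewrite bE //; have [k mk le] := fixed_belowPn nfbt.
  by have [_] := inv i i_n Pi; apply; [exact: mk | exact: leq_ltn_trans lt].
- rewrite /work; case: ifP => // nfb; case: ifP => [/fbE|_]; first by rewrite nfb.
  exact: leq_sub2l (dptE i Pi).
(* If the descent is outside [Q], all of [Q] ranks before the first mismatch: it is now settled, and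
   its positive work drops to 0. *)
have [Qt|lt] := low t (ltn_ord t) Pt nfbt.
  exists t; split=> //; rewrite /work (negPf nfbt).
  have := dpt_leq (b' t); rewrite dt => lt; case: ifP => _; lia.
have [t0 [t0n Pt0 Qt0 wt]] := ex_work inv ex low.
exists t0; split=> //; rewrite {1}/work (_ : fixed_below b' r' t0) //.
apply/fixed_belowP => j /mm /min; apply: leq_trans; exact: lt.
Qed.

End Priority.

(** * The endgame in the two coordinates of a leaf *)

(* [Ordinary]: one cop and two coordinates; [Single]: one cop and one         *)
(* coordinate, the second one being a dummy; [Double]: two cops and two       *)
(* coordinates.                                                               *)
Variant kind := Ordinary | Single | Double.

(* Only depths matter in the endgame: [p1], [p2] are those of the robber,     *)
(* [b1], [b2] those of the rear cop, [f1], [f2] those of the front cop, which *)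
(* for a [Double] team starts at the same place and then stays one step ahead *)
(* of the rear cop. At the robber's turn a cop at even distance is balanced:  *)
(* it has not left the root in the coordinate where it is closer, so that the *)
(* robber cannot slip past it there.                                          *)
Definition even_balanced (b1 b2 c1 c2 p1 p2 : nat) :=
  (p1 - b1 < p2 - b2 -> b1 = 0 /\ c1 = 0) /\
  (p2 - b2 < p1 - b1 -> b2 = 0 /\ c2 = 0).

Definition depth_inv k (b1 b2 f1 f2 p1 p2 : nat) :=
  match k with
  | Single => f1 = b1 /\ f2 = b2 /\ b2 = p2
  | Ordinary => f1 = b1 /\ f2 = b2 /\
      if odd (p1 - b1 + (p2 - b2)) then b1 = 0 /\ b2 = 0
      else even_balanced b1 b2 b1 b2 p1 p2
  | Double =>
      if (f1 == b1) && (f2 == b2) then b1 = 0 /\ b2 = 0 else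
      (f1 = b1.+1 /\ f2 = b2 \/ f1 = b1 /\ f2 = b2.+1) /\
      if odd (p1 - b1 + (p2 - b2)) then even_balanced f1 f2 b1 b2 p1 p2
      else even_balanced b1 b2 f1 f2 p1 p2
  end.

(* [Some false] and [Some true] are moves in the first and second coordinate. *)
Definition local_rule k (b1 b2 f1 f2 p1 p2 : nat) : option bool * option bool :=
  match k with
  | Single => (Some false, Some false)
  | Ordinary =>
      let m := if odd (p1 - b1 + (p2 - b2)) then Some (p1 - b1 < p2 - b2) else None in
      (m, m)
  | Double =>
      if (f1 == b1) && (f2 == b2) then (None, Some (p1 - f1 < p2 - f2)) else
      let m := if odd (p1 - b1 + (p2 - b2)) then p1 - b1 < p2 - b2
               else p1 - f1 < p2 - f2 in
      (Some m, Some m)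
  end.

(* The extra unit is the round in which an [Ordinary] cop passes to fix the   *)
(* parity, or the front cop of a [Double] team leaves the rear cop.           *)
Definition depth_work k R1 R2 (b1 b2 f1 f2 p1 p2 : nat) : nat :=
  match k with
  | Single => R1 - b1
  | Ordinary => (R1 - b1) + (R2 - b2) + odd (p1 - b1 + (p2 - b2))
  | Double => (R1 - b1) + (R2 - b2) + ((f1 == b1) && (f2 == b2))
  end.

Definition near (p q : nat) := q = p.+1 \/ p = q.+1.

Definition local_move k p1 p2 q1 q2 :=
  (if k is Single then q2 = p2 else True) /\
  ((q1 = p1 /\ q2 = p2) \/ (near p1 q1 /\ q2 = p2) \/ (q1 = p1 /\ near p2 q2)).

Definition inc1 (m : option bool) b := if m is Some false then b.+1 else b.
Definition inc2 (m : option bool) b := if m is Some true then b.+1 else b.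

(** For an ancestor of the robber this excludes one case: the robber climbs from the cop's own
    vertex, which is not the root. *)
Definition stays_below b p q := b < p \/ b = 0 \/ q = p \/ q = p.+1.

Definition below b1 b2 p1 p2 := b1 <= p1 /\ b2 <= p2 /\ b1 + b2 < p1 + p2.

(** Splits on the robber's move, the kind, the parities and the comparisons of distances; each case
    is linear arithmetic. *)
Ltac by_kind :=
  rewrite /local_rule /depth_inv /depth_work /local_move /near /even_balanced
    /stays_below /below;
  intros [? [[? ?]|[[[?|?] ?]|[? [?|?]]]]]; subst;
  (match goal with k : kind |- _ => destruct k; cbv iota in * end;
  [ case=> -> [-> +]
  | case=> -> [-> ->]
  | case: ifP => [/andP[/eqP-> /eqP->] [-> ->]|_ [[] [-> ->]]] ]);
  rewrite /inc1 /inc2 ?eqxx /=;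
  repeat match goal with |- context [odd ?x] =>
    lazymatch x with context [if _ then _ else _] => fail | _ => idtac end;
    case: (boolP (odd x)) => ? /= end;
  repeat match goal with |- context [if ?a < ?b then _ else _] =>
    case: (ltnP a b) => ? /= end;
  rewrite ?eqxx /=;
  repeat match goal with |- context [odd ?x] => case: (boolP (odd x)) => ? /= end;
  repeat match goal with |- context [if ?b then _ else _] => case: (boolP b) => ? end;
  try lia.

Section Depths.
Variables (k : kind) (R1 R2 b1 b2 f1 f2 p1 p2 q1 q2 : nat).
Let m := local_rule k b1 b2 f1 f2 q1 q2.
Let b1' := inc1 m.1 b1.
Let b2' := inc2 m.1 b2.
Let f1' := inc1 m.2 f1.
Let f2' := inc2 m.2 f2.

Lemma lead_stays_below :
    local_move k p1 p2 q1 q2 ->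
    depth_inv k b1 b2 f1 f2 p1 p2 -> below b1 b2 p1 p2 -> below f1 f2 p1 p2 ->
  stays_below b1 p1 q1 /\ stays_below b2 p2 q2.
Proof.
by by_kind.
Qed.

(** The robber can slip above the front cop only if the rear cop is at distance 1 in both
    coordinates; the move then leaves the rear cop one step from capture. *)
Lemma front_stays_below :
    local_move k p1 p2 q1 q2 ->
    depth_inv k b1 b2 f1 f2 p1 p2 -> below b1 b2 p1 p2 -> below f1 f2 p1 p2 ->
  (stays_below f1 p1 q1 /\ stays_below f2 p2 q2) \/
  b1 <= q1 /\ b2 <= q2 /\ b1' = q1 /\ b2' = q2.
Proof.
rewrite /b1' /b2' /m; clear; by_kind.
Qed.

Lemma local_rule_leq :
    local_move k p1 p2 q1 q2 ->
    depth_inv k b1 b2 f1 f2 p1 p2 -> below b1 b2 p1 p2 -> below f1 f2 p1 p2 ->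
    below b1 b2 q1 q2 -> below f1 f2 q1 q2 ->
  b1' <= q1 /\ b2' <= q2 /\ (f1' <= q1 /\ f2' <= q2 \/ b1' = q1 /\ b2' = q2).
Proof.
rewrite /b1' /b2' /f1' /f2' /m; clear; by_kind.
Qed.

(** Reducing the larger of two distances with odd sum never makes it the smaller one. If they still
    differ, then by at least 2, hence by at least 3 before the cop's move; so the same coordinate
    was already the closer one at the robber's turn, and the invariant had its cop at the root. *)
Lemma local_rule_inv :
    local_move k p1 p2 q1 q2 ->
    depth_inv k b1 b2 f1 f2 p1 p2 -> below b1 b2 p1 p2 -> below f1 f2 p1 p2 ->
    below b1 b2 q1 q2 -> below f1 f2 q1 q2 ->
    below b1' b2' q1 q2 -> below f1' f2' q1 q2 ->
  depth_inv k b1' b2' f1' f2' q1 q2.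
Proof.
rewrite /b1' /b2' /f1' /f2' /m; clear; by_kind.
Qed.

(** Once an [Ordinary] cop is at even distance at the robber's turn it remains so: it advances when
    the robber moves and passes when it passes. Before that, either reply clears the parity unit. In
    a separated [Double] team one cop is always at odd distance, so the team advances in every
    round. *)
Lemma local_rule_work :
    q1 <= R1 -> q2 <= R2 ->
    local_move k p1 p2 q1 q2 ->
    depth_inv k b1 b2 f1 f2 p1 p2 -> below b1 b2 p1 p2 -> below f1 f2 p1 p2 ->
    below b1 b2 q1 q2 -> below f1 f2 q1 q2 ->
    below b1' b2' q1 q2 -> below f1' f2' q1 q2 ->
  depth_work k R1 R2 b1' b2' f1' f2' q1 q2 +
    (~~ ((q1 == p1) && (q2 == p2)) || if k is Ordinary then false else true) <=
  depth_work k R1 R2 b1 b2 f1 f2 p1 p2.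
Proof.
rewrite /b1' /b2' /f1' /f2' /m; clear.
move=> qR1 qR2; by_kind.
Qed.

End Depths.

Lemma anc_stays_below (G : sgraph) (rt : rooting G) (x r r' : G) :
    anc rt x r -> r' = r \/ adj r r' ->
    stays_below (dpt rt x) (dpt rt r) (dpt rt r') ->
  anc rt x r'.
Proof.
move=> a [->//|rr']; rewrite /stays_below => -[lt|[/eqP|[e|e]]].
- by apply: (anc_adj a) rr'; rewrite (anc_eq a); lia.
- by rewrite dpt_eq0 => /eqP->; apply: anc_root.
- by case: (adj_dpt rt rr'); rewrite e => /n_Sn.
- have [x'|x'] := adj_par rt rr'.
    have [rz|rz] := eqVneq r (rt_root rt); last by have := dpt_par rz; rewrite x'; lia.
    by move: rr'; rewrite -x' rz par_root adj_irr.
  by case/ancP: a => j <-; apply/ancP; exists j.+1; rewrite iterSr x'.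
Qed.

(** * The endgame on vertices instead of depths *)

Section LeafMove.
Variables (G : sgraph) (rt : rooting G).

Definition move1 (m : option bool) (x r : G) :=
  if m is Some false then toward rt x r else x.
Definition move2 (m : option bool) (x r : G) :=
  if m is Some true then toward rt x r else x.

Lemma toward_leq x r : anc rt x r -> dpt rt x < dpt rt r ->
  anc rt (toward rt x r) r /\ dpt rt (toward rt x r) = (dpt rt x).+1.
Proof.
move=> a lt; have ne : x != r by rewrite (anc_eq a); lia.
by split; [apply: anc_toward | apply: dpt_toward].
Qed.

Lemma move1P m x r : anc rt x r -> inc1 m (dpt rt x) <= dpt rt r ->
  anc rt (move1 m x r) r /\ dpt rt (move1 m x r) = inc1 m (dpt rt x).
Proof. by case: m => [[]|] //=; apply: toward_leq. Qed.

Lemma move2P m x r : anc rt x r -> inc2 m (dpt rt x) <= dpt rt r ->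
  anc rt (move2 m x r) r /\ dpt rt (move2 m x r) = inc2 m (dpt rt x).
Proof. by case: m => [[]|] //=; apply: toward_leq. Qed.
End LeafMove.

Section Leaf.
Variables (G1 G2 : sgraph) (rt1 : rooting G1) (rt2 : rooting G2).
Local Notation d1 := (dpt rt1).
Local Notation d2 := (dpt rt2).

Definition leaf_inv k (x1 : G1) (x2 : G2) y1 y2 r1 r2 :=
  [/\ anc rt1 x1 r1 /\ anc rt2 x2 r2, anc rt1 y1 r1 /\ anc rt2 y2 r2 &
      depth_inv k (d1 x1) (d2 x2) (d1 y1) (d2 y2) (d1 r1) (d2 r2)].

Lemma belowP (x1 : G1) (x2 : G2) r1 r2 : anc rt1 x1 r1 -> anc rt2 x2 r2 ->
  ~ (x1 = r1 /\ x2 = r2) <-> below (d1 x1) (d2 x2) (d1 r1) (d2 r2).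
Proof.
move=> a1 a2; have l1 := anc_leq a1; have l2 := anc_leq a2; split=> [ne|].
  split=> //; split=> //; rewrite ltnNge; apply/negP => le; apply: ne.
  by split; apply/eqP; rewrite ?(anc_eq a1) ?(anc_eq a2); apply/eqP; lia.
by case=> _ [_ lt] [e1 e2]; rewrite e1 e2 ltnn in lt.
Qed.

Variables (k : kind) (R1 R2 : nat).
Hypotheses (dR1 : forall x, d1 x <= R1) (dR2 : forall x, d2 x <= R2).

Lemma leaf_round (x1 y1 r1 r1' : G1) (x2 y2 r2 r2' : G2) :
    leaf_inv k x1 x2 y1 y2 r1 r2 ->
    ~ (x1 = r1 /\ x2 = r2) -> ~ (y1 = r1 /\ y2 = r2) ->
    (k = Single -> r2' = r2) ->
    [\/ r1' = r1 /\ r2' = r2, adj r1 r1' /\ r2' = r2 | r1' = r1 /\ adj r2 r2'] ->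
    ~ (x1 = r1' /\ x2 = r2') -> ~ (y1 = r1' /\ y2 = r2') ->
  let m := local_rule k (d1 x1) (d2 x2) (d1 y1) (d2 y2) (d1 r1') (d2 r2') in
  let x1' := move1 rt1 m.1 x1 r1' in let x2' := move2 rt2 m.1 x2 r2' in
  let y1' := move1 rt1 m.2 y1 r1' in let y2' := move2 rt2 m.2 y2 r2' in
  [\/ x1' = r1' /\ x2' = r2', y1' = r1' /\ y2' = r2' |
      leaf_inv k x1' x2' y1' y2' r1' r2' /\
      depth_work k R1 R2 (d1 x1') (d2 x2') (d1 y1') (d2 y2') (d1 r1') (d2 r2')
        + ((r1' != r1) || (r2' != r2) || if k is Ordinary then false else true)
      <= depth_work k R1 R2 (d1 x1) (d2 x2) (d1 y1) (d2 y2) (d1 r1) (d2 r2)].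
Proof.
case=> -[ax1 ax2] [ay1 ay2] inv.
move=> /(belowP ax1 ax2) bx /(belowP ay1 ay2) by_ single mv nx ny m x1' x2' y1' y2'.
have lm : local_move k (d1 r1) (d2 r2) (d1 r1') (d2 r2').
  split; first by move: single; case: (k) => // /(_ erefl) ->.
  case: mv => -[]; first by move=> -> ->; left.
    by move=> a ->; right; left; split=> //; apply: adj_dpt.
  by move=> -> a; right; right; split=> //; apply: adj_dpt.
have mv1 : r1' = r1 \/ adj r1 r1' by case: mv => -[? ?]; [left|right|left].
have mv2 : r2' = r2 \/ adj r2 r2' by case: mv => -[? ?]; [left|left|right].
have same : (~~ ((d1 r1' == d1 r1) && (d2 r2' == d2 r2))) =
            ((r1' != r1) || (r2' != r2)).
  rewrite negb_and; case: mv => -[].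
  - by move=> -> ->; rewrite !eqxx.
  - move=> a ->; rewrite !eqxx !orbF.
    have -> : r1' != r1 by apply/eqP => e; rewrite e adj_irr in a.
    by case: (adj_dpt rt1 a); lia.
  - move=> -> a; rewrite !eqxx /=.
    have -> : r2' != r2 by apply/eqP => e; rewrite e adj_irr in a.
    by case: (adj_dpt rt2 a); lia.
have [sx1 sx2] := lead_stays_below lm inv bx by_.
have {}ax1 := anc_stays_below ax1 mv1 sx1.
have {}ax2 := anc_stays_below ax2 mv2 sx2.
have cap : inc1 m.1 (d1 x1) = d1 r1' -> inc2 m.1 (d2 x2) = d2 r2' ->
    x1' = r1' /\ x2' = r2'.
  move=> e1 e2; have [|a1 f1] := @move1P _ rt1 m.1 x1 r1' ax1; first by rewrite e1.
  have [|a2 f2] := @move2P _ rt2 m.1 x2 r2' ax2; first by rewrite e2.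
  by split; apply/eqP; rewrite ?(anc_eq a1) ?(anc_eq a2) ?f1 ?f2 ?e1 ?e2.
have [[sy1 sy2]|[_ [_ [e1 e2]]]] := front_stays_below lm inv bx by_; last first.
  by constructor 1; apply: cap.
have {}ay1 := anc_stays_below ay1 mv1 sy1.
have {}ay2 := anc_stays_below ay2 mv2 sy2.
have /(belowP ax1 ax2) bx' := nx; have /(belowP ay1 ay2) by' := ny.
have [lx1 [lx2 [[ly1 ly2]|[e1 e2]]]] := local_rule_leq lm inv bx by_ bx' by'; last first.
  by constructor 1; apply: cap.
have [ax1' ex1] : anc rt1 x1' r1' /\ d1 x1' = _ := move1P ax1 lx1.
have [ax2' ex2] : anc rt2 x2' r2' /\ d2 x2' = _ := move2P ax2 lx2.
have [ay1' ey1] : anc rt1 y1' r1' /\ d1 y1' = _ := move1P ay1 ly1.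
have [ay2' ey2] : anc rt2 y2' r2' /\ d2 y2' = _ := move2P ay2 ly2.
have [?|cx] := pselect (x1' = r1' /\ x2' = r2'); first by constructor 1.
have [?|cy] := pselect (y1' = r1' /\ y2' = r2'); first by constructor 2.
constructor 3.
have bx'' : below (inc1 m.1 (d1 x1)) (inc2 m.1 (d2 x2)) (d1 r1') (d2 r2').
  by rewrite -ex1 -ex2; apply/(belowP ax1' ax2').
have by'' : below (inc1 m.2 (d1 y1)) (inc2 m.2 (d2 y2)) (d1 r1') (d2 r2').
  by rewrite -ey1 -ey2; apply/(belowP ay1' ay2').
have inv' := local_rule_inv lm inv bx by_ bx' by' bx'' by''.
have wk := local_rule_work (dR1 r1') (dR2 r2') lm inv bx by_ bx' by' bx'' by''.
rewrite -same; split; last by rewrite ex1 ex2 ey1 ey2; exact: wk.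
by split=> //; rewrite ex1 ex2 ey1 ey2.
Qed.

End Leaf.

(** A free robber is at a positive distance. If this is even it is at least 2; if odd, the parity
    unit is added. In a [Double] team the front cop adds its lead, or the unit for leaving the rear
    cop. *)
Lemma depth_work_ge k R1 R2 b1 b2 f1 f2 p1 p2 :
    p1 <= R1 -> p2 <= R2 -> depth_inv k b1 b2 f1 f2 p1 p2 ->
    below b1 b2 p1 p2 -> below f1 f2 p1 p2 ->
  (if k is Single then 1 else 2) <= depth_work k R1 R2 b1 b2 f1 f2 p1 p2.
Proof.
move=> pR1 pR2; rewrite /depth_inv /depth_work /below /even_balanced.
case: k => [[-> [->]]|[-> [-> ->]]|]; [|lia|].
  by case: (boolP (odd _)) => ?; lia.
by case: ifP => [/andP[/eqP-> /eqP->] _|_ []]; lia.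
Qed.

Definition work0 k (R1 R2 : nat) := if k is Single then R1 else (R1 + R2).+1.

Lemma leaf_inv_root (G1 G2 : sgraph) (rt1 : rooting G1) (rt2 : rooting G2) k r1 r2 :
    (k = Single -> r2 = rt_root rt2) ->
  leaf_inv rt1 rt2 k (rt_root rt1) (rt_root rt2) (rt_root rt1) (rt_root rt2) r1 r2.
Proof.
move=> single; split; try by split; apply: anc_root.
rewrite !dpt_root /depth_inv /even_balanced; case: k single => [_|->//|_]; last by [].
  by rewrite !subn0; case: ifP.
by rewrite dpt_root.
Qed.

Lemma depth_work_root k R1 R2 p1 p2 : depth_work k R1 R2 0 0 0 0 p1 p2 <= work0 k R1 R2.
Proof. by rewrite /depth_work /work0; case: k; rewrite ?subn0 //=; lia. Qed.

(** * One team: correcting the outside coordinates, then the endgame in its leaf *)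

Section Team.
Variables (T : nat -> sgraph) (rt : forall i, rooting (T i)) (R : nat -> nat).
Hypothesis dpt_leq : forall i x, dpt (rt i) x <= R i.
Variables (n l : nat) (k : kind) (rk : nat -> nat).
Hypothesis rk_inj : forall i j, i < n -> j < n -> rk i = rk j -> i = j.
Hypothesis l_n : l.*2 < n.
Hypothesis l_n1 : if k is Single then n <= l.*2.+1 else l.*2.+1 < n.
Implicit Types B F r : pos T.

Definition outside i := i./2 != l.

Lemma insideP i : ~~ outside i -> i = l.*2 \/ i = l.*2.+1.
Proof. rewrite /outside negbK => /eqP; lia. Qed.

Lemma inside1 : ~~ outside l.*2. Proof. rewrite /outside; lia. Qed.
Lemma inside2 : ~~ outside l.*2.+1. Proof. rewrite /outside; lia. Qed.

Definition leaf_move (m : option bool) B r :=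
  match m with
  | Some false => move_toward rt B l.*2 r
  | Some true => move_toward rt B l.*2.+1 r
  | None => B
  end.

Definition leaf_rule B F r :=
  local_rule k (dpt (rt l.*2) (B l.*2)) (dpt (rt l.*2.+1) (B l.*2.+1))
    (dpt (rt l.*2) (F l.*2)) (dpt (rt l.*2.+1) (F l.*2.+1))
    (dpt (rt l.*2) (r l.*2)) (dpt (rt l.*2.+1) (r l.*2.+1)).

Definition leaf_work B F r :=
  depth_work k (R l.*2) (R l.*2.+1)
    (dpt (rt l.*2) (B l.*2)) (dpt (rt l.*2.+1) (B l.*2.+1))
    (dpt (rt l.*2) (F l.*2)) (dpt (rt l.*2.+1) (F l.*2.+1))
    (dpt (rt l.*2) (r l.*2)) (dpt (rt l.*2.+1) (r l.*2.+1)).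

Definition team_next (c : pos T * pos T) r : pos T * pos T :=
  if first_mismatch n outside rk c.1 r is Some t
  then (move_toward rt c.1 t r, move_toward rt c.2 t r)
  else let m := leaf_rule c.1 c.2 r in (leaf_move m.1 c.1 r, leaf_move m.2 c.2 r).

Definition dirty B r := [exists i : 'I_n, mismatch n outside B r i].

Definition team_inv B F r :=
  [/\ prio_inv rt n outside rk B r,
      forall i, outside i -> F i = B i,
      k <> Double -> F = B &
      if dirty B r then
        forall i, ~~ outside i -> B i = rt_root (rt i) /\ F i = rt_root (rt i)
      else leaf_inv (rt l.*2) (rt l.*2.+1) k (B l.*2) (B l.*2.+1)
             (F l.*2) (F l.*2.+1) (r l.*2) (r l.*2.+1)].

Definition team_work B F r :=
  if dirty B r then work0 k (R l.*2) (R l.*2.+1) else leaf_work B F r.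

Definition caught_at B r := forall i, i < n -> B i = r i.
Definition in_play r := forall i, n <= i -> r i = rt_root (rt i).

Lemma dirtyPn B r : reflect (forall i, ~~ mismatch n outside B r i) (~~ dirty B r).
Proof.
apply: (iffP existsPn) => h i //; apply/negP => mi.
by have i_n : i < n by [case/andP: mi]; have := h (Ordinal i_n); rewrite /= mi.
Qed.

Lemma clean_caught B r : ~~ dirty B r ->
  B l.*2 = r l.*2 /\ B l.*2.+1 = r l.*2.+1 -> caught_at B r.
Proof.
move=> /dirtyPn cl [e1 e2] i i_n; have [oi|/insideP[]->//] := boolP (outside i).
by have := cl i; rewrite /mismatch i_n oi /= negbK => /eqP.
Qed.

Lemma leaf_move_out m B r i : outside i -> leaf_move m B r i = B i.
Proof.
by move=> oi; case: m => [[]|] //=; rewrite move_toward_out //;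
  apply: contraTneq oi => ->; rewrite ?inside1 ?inside2.
Qed.

Lemma leaf_move1 m B r :
  leaf_move m B r l.*2 = move1 (rt l.*2) m (B l.*2) (r l.*2).
Proof.
by case: m => [[]|] //=; rewrite ?move_toward_in // move_toward_out //; lia.
Qed.

Lemma leaf_move2 m B r :
  leaf_move m B r l.*2.+1 = move2 (rt l.*2.+1) m (B l.*2.+1) (r l.*2.+1).
Proof.
by case: m => [[]|] //=; rewrite ?move_toward_in // move_toward_out //; lia.
Qed.

Lemma team_next_legal B F r :
  pos_step n B (team_next (B, F) r).1 /\ pos_step n F (team_next (B, F) r).2.
Proof.
rewrite /team_next; case: first_mismatchP => [t _ _|_] /=.
  by split; apply: move_toward_step.
have st m f : (if k is Single then m <> Some true else True) ->
    pos_step n f (leaf_move m f r).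
  case: m => [[]|] /= h; [|exact: move_toward_step|by left].
  by apply: move_toward_step; move: h l_n1; case: (k) => // /(_ erefl).
by split; apply: st; rewrite /leaf_rule; case: (k).
Qed.

Lemma team_work_ge B F r : team_inv B F r -> 0 < R l.*2 ->
    ~ caught_at B r -> ~ caught_at F r ->
  (if k is Single then 1 else 2) <= team_work B F r.
Proof.
move=> [_ FB _ lf] R0 nB nF; rewrite /team_work; case: ifP lf => [_ _|/negbT cl].
  by rewrite /work0; case: (k); lia.
case=> -[a1 a2] [a3 a4] inv; apply: depth_work_ge => //.
  by apply/belowP => //; move=> e; apply: nB; apply: clean_caught e.
apply/belowP => // e; apply: nF; apply: clean_caught e.
apply/dirtyPn => i; have /dirtyPn/(_ i) := cl; rewrite /mismatch.
by case: (boolP (outside i)) => [/FB ->|]; rewrite ?andbF.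
Qed.

Section TeamRound.
Variables B F r r' : pos T.
Hypotheses (inv : team_inv B F r) (rr' : pos_step n r r').
Hypotheses (ir : in_play r) (ir' : in_play r').
Hypotheses (nB : ~ caught_at B r) (nF : ~ caught_at F r).
Hypotheses (nB' : ~ caught_at B r') (nF' : ~ caught_at F r').
Local Notation B' := (team_next (B, F) r').1.
Local Notation F' := (team_next (B, F) r').2.

Lemma team_prio i : outside i -> B' i = prio_move rt n outside rk B r' i.
Proof.
move=> oi; rewrite /team_next /prio_move /=.
by case: first_mismatchP => [t|_] //=; rewrite leaf_move_out.
Qed.

Lemma team_prio_inv : [/\ prio_inv rt n outside rk B' r',
    forall i, outside i -> F' i = B' i & k <> Double -> F' = B'].
Proof.
have [pinv FB FB2 _] := inv; split.
- by have [] := prio_round dpt_leq rk_inj pinv rr' team_prio.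
- move=> i oi; rewrite /team_next /=; case: first_mismatchP => [t /and3P[_ ot _] _|_] /=.
    have [->|it] := eqVneq i t; first by rewrite !move_toward_in FB.
    by rewrite !move_toward_out // FB.
  by rewrite !leaf_move_out // FB.
- move=> nk; rewrite /team_next /=; case: first_mismatchP => [t _ _|_] /=.
    by rewrite FB2.
  by rewrite FB2 // /leaf_rule; case: (k) nk.
Qed.

(** A dirty team keeps its leaf coordinates at the root, so [work0] covers the endgame whenever it
    starts. A clean team copies robber moves outside its leaf and plays the endgame otherwise. *)
Lemma team_round :
  [\/ caught_at B' r', caught_at F' r' |
    team_inv B' F' r' /\
    team_work B' F' r' + (~~ dirty B r && ([exists i : 'I_n, ~~ outside i && (r' i != r i)]
       || `[< r' = r >] && if k is Ordinary then false else true)) <= team_work B F r].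
Proof.
have [pinv FB FB2 lf] := inv; have [pinv' FB' FB2'] := team_prio_inv.
have rootE C : in_play C -> k = Single -> C l.*2.+1 = rt_root (rt l.*2.+1).
  by move=> iC ks; apply: iC; move: l_n1; rewrite ks.
have outB i : outside i -> B' i = prio_move rt n outside rk B r' i := @team_prio i.
rewrite /team_inv /team_work /leaf_work.
have rE j : outside j -> r' j != r j -> forall i, ~~ outside i -> r' i = r i.
  move=> oj; case: rr' => [->|[j0 [_ _ out]]]; first by rewrite eqxx.
  have [e _ i ii|/out->] := eqVneq j j0; last by rewrite eqxx.
  by apply: out; apply: contraNneq ii => ->; rewrite -e.
have := first_mismatchP n outside rk B r'.
case E : (first_mismatch n outside rk B r') => [t|] spec.
  inversion spec as [t0 mt min e|]; subst t0.
  have /and3P[tn ot ne] := mt.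
  have nextE : team_next (B, F) r' = (move_toward rt B t r', move_toward rt F t r').
    by rewrite /team_next /= E.
  have B'E i : ~~ outside i -> B' i = B i.
    by move=> ii; rewrite nextE; apply: move_toward_out; apply: contraNneq ii => ->.
  have F'E i : ~~ outside i -> F' i = F i.
    by move=> ii; rewrite nextE; apply: move_toward_out; apply: contraNneq ii => ->.
  constructor 3; case: (boolP (dirty B r)) lf => [dB roots|clB lf] /=.
    rewrite addn0; case: (boolP (dirty B' r')) => [_|clB'].
      by do 2![split=> //] => i ii; rewrite B'E // F'E //; apply: roots.
    have [ra1 rb1] := roots _ inside1; have [ra2 rb2] := roots _ inside2.
    rewrite !B'E ?F'E ?inside1 ?inside2 // ra1 ra2 rb1 rb2; split.
      by split=> //; apply: leaf_inv_root; apply: rootE.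
    by rewrite !dpt_root depth_work_root.
  have rt_t : r' t != r t.
    by have /dirtyPn/(_ t) := clB; rewrite /mismatch tn ot /= negbK => /eqP <-; rewrite eq_sym.
  have fb : fixed_below n outside rk B r t.
    by apply/fixed_belowP => j; rewrite (negPf (dirtyPn _ _ clB j)).
  have [mE _] := prio_follow rr' team_prio ot rt_t fb.
  have clB' : ~~ dirty B' r' by apply/dirtyPn => i; rewrite mE; apply/dirtyPn.
  have {}rE := rE t ot rt_t.
  rewrite (negPf clB') !B'E ?F'E ?rE ?inside1 ?inside2 //; split; first by [].
  rewrite (_ : _ || _ = false) ?addn0 //; apply: negbTE; apply/norP; split.
    by apply/existsPn => i; apply/negP => /andP[ii]; rewrite rE ?eqxx.
  by apply/negP => /andP[/asboolP e _]; rewrite e eqxx in rt_t.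
inversion spec as [|cl e].
have outE i : outside i -> B' i = B i by move=> oi; rewrite outB // /prio_move E.
have clB' : ~~ dirty B' r'.
  apply/dirtyPn => i; have := cl i; rewrite /mismatch.
  by case: (boolP (outside i)) => [/outE->|]; rewrite ?andbF.
rewrite (negPf clB').
have clB : ~~ dirty B r' by apply/dirtyPn.
have clF : ~~ dirty F r'.
  apply/dirtyPn => i; have := cl i; rewrite /mismatch.
  by case: (boolP (outside i)) => [/FB ->|]; rewrite ?andbF.
have nb := fun e => nB' (clean_caught clB e); have nf := fun e => nF' (clean_caught clF e).
have B'a := leaf_move1 (leaf_rule B F r').1 B r'.
have B'b := leaf_move2 (leaf_rule B F r').1 B r'.
have F'a := leaf_move1 (leaf_rule B F r').2 F r'.
have F'b := leaf_move2 (leaf_rule B F r').2 F r'.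
have nextE : team_next (B, F) r' =
    (leaf_move (leaf_rule B F r').1 B r', leaf_move (leaf_rule B F r').2 F r').
  by rewrite /team_next /= E.
have single : k = Single -> r' l.*2.+1 = r l.*2.+1.
  by move=> ks; rewrite (rootE r ir ks) (rootE r' ir' ks).
have cF' : ~~ dirty F' r'.
  apply/dirtyPn => i; have /dirtyPn/(_ i) := clB'; rewrite /mismatch.
  by case: (boolP (outside i)) => [/FB' ->|]; rewrite ?andbF.
suff [lr nr nr' mv wk] : [/\ leaf_inv (rt l.*2) (rt l.*2.+1) k (B l.*2) (B l.*2.+1)
             (F l.*2) (F l.*2.+1) (r l.*2) (r l.*2.+1),
    ~ (B l.*2 = r l.*2 /\ B l.*2.+1 = r l.*2.+1),
    ~ (F l.*2 = r l.*2 /\ F l.*2.+1 = r l.*2.+1),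
    [\/ r' l.*2 = r l.*2 /\ r' l.*2.+1 = r l.*2.+1,
        adj (r l.*2) (r' l.*2) /\ r' l.*2.+1 = r l.*2.+1 |
        r' l.*2 = r l.*2 /\ adj (r l.*2.+1) (r' l.*2.+1)] &
    leaf_work B F r <= team_work B F r].
  have [] := leaf_round (dpt_leq (i := l.*2)) (dpt_leq (i := l.*2.+1)) lr nr nr' single mv nb nf.
  - rewrite -B'a -B'b => cc; constructor 1; apply: clean_caught clB' _.
    by rewrite nextE.
  - rewrite -F'a -F'b => cc; constructor 2; apply: clean_caught cF' _.
    by rewrite nextE.
  rewrite -B'a -B'b -F'a -F'b => -[li lw]; constructor 3; split.
    by split=> //; rewrite nextE.
  apply: leq_trans wk; apply: leq_trans lw; rewrite nextE leq_add2l.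
  case: andP => [[_ /orP[/existsP[i /andP[ii]]|/andP[_ kk]]]|//].
    by have [ei|ei] := insideP ii; rewrite ei => ->; rewrite ?orbT.
  by rewrite kk !orbT.
(* A dirty team can meet no mismatch when the robber itself removes the last one; that move is
   outside the leaf, so the endgame starts from the roots. *)
case: (boolP (dirty B r)) lf => [dB roots|clBr lf].
  have [j mj] := existsP dB; have /and3P[jn oj bj] := mj.
  have rj : r' j != r j.
    by have := cl j; rewrite /mismatch jn oj /= negbK => /eqP <-.
  have r1 := rE j oj rj _ inside1; have r2 := rE j oj rj _ inside2.
  split.
  - have [ra1 rb1] := roots _ inside1; have [ra2 rb2] := roots _ inside2.
    by rewrite ra1 ra2 rb1 rb2; apply: leaf_inv_root; apply: rootE.
  - by rewrite -r1 -r2.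
  - by rewrite -r1 -r2.
  - by constructor 1.
  - have [ra1 rb1] := roots _ inside1; have [ra2 rb2] := roots _ inside2.
    by rewrite /leaf_work /team_work dB ra1 ra2 rb1 rb2 !dpt_root depth_work_root.
split=> //.
- by move=> cc; apply: nB; apply: clean_caught clBr cc.
- move=> cc; apply: nF; apply: clean_caught cc.
  apply/dirtyPn => i; have /dirtyPn/(_ i) := clBr; rewrite /mismatch.
  by case: (boolP (outside i)) => [/FB ->|]; rewrite ?andbF.
- case: rr' => [->|[i [i_n a out]]]; first by constructor 1.
  case: (boolP (outside i)) => [oi|/insideP[ei|ei]].
  + exfalso; have ne : r i != r' i by apply/eqP => ri; rewrite ri adj_irr in a.
    have := cl i; have /dirtyPn/(_ i) := clBr; rewrite /mismatch i_n oi /= !negbK.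
    by move=> /eqP -> /eqP ri; rewrite ri eqxx in ne.
  + by constructor 2; rewrite -ei; split=> //; apply: out; lia.
  + by constructor 3; rewrite -ei; split=> //; apply: out; lia.
- by rewrite /team_work (negPf clBr).
Qed.

End TeamRound.
End Team.

(** * Charging rounds to a binary tree *)

Lemma ltn_sum_at (I : finType) (P : pred I) (F F' : I -> nat) j : P j ->
    (forall i, P i -> F' i <= F i) -> F' j < F j ->
  \sum_(i | P i) F' i < \sum_(i | P i) F i.
Proof.
move=> Pj le lt; rewrite (bigD1 j) //= (bigD1 j Pj) /= -addSn leq_add //.
by apply: leq_sum => i /andP[]; auto.
Qed.

(* The nodes of the binary tree whose leaves are the teams are the residue   *)
(* classes modulo the powers of 2. A round in which the robber moves in the  *)
(* leaf [l0] is charged to the shallowest unfinished node above [l0].        *)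
Section Charging.
Variables (M h : nat).
Implicit Types (phi : nat -> nat -> nat) (psi : nat -> nat).

(** A maximum per class, since all its teams correct the coordinates of the same sibling class and
    advance in the same rounds. *)
Definition total_work phi psi :=
  \sum_(p < h) \sum_(s < 2 ^ p.+1) \max_(l < M | l %% 2 ^ p.+1 == s) phi p l
  + \sum_(l < M) psi l.

Lemma total_work_decr phi psi phi' psi' (fin : nat -> nat -> bool) l0 : l0 < M ->
    (forall p l, l < M -> phi' p l <= phi p l) -> (forall l, l < M -> psi' l <= psi l) ->
    (forall p l, fin p l -> phi p l = 0) ->
    (forall p l, p < h -> l < M -> l = l0 %[mod 2 ^ p.+1] ->
       (forall q, q < p -> fin q l) -> ~~ fin p l -> phi' p l < phi p l) ->
    ((forall p, p < h -> fin p l0) -> psi' l0 < psi l0) ->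
  total_work phi' psi' < total_work phi psi.
Proof.
move=> l0M phile psile fin0 philt psilt.
have maxle p s : \max_(l < M | l %% 2 ^ p.+1 == s) phi' p l <=
    \max_(l < M | l %% 2 ^ p.+1 == s) phi p l.
  apply/bigmax_leqP => l ls; apply: leq_trans (phile p l (ltn_ord l)) _.
  exact: (@leq_bigmax_cond _ _ (fun l : 'I_M => phi p l)).
have sumle (p : 'I_h) : \sum_(s < 2 ^ p.+1) \max_(l < M | l %% 2 ^ p.+1 == s) phi' p l <=
    \sum_(s < 2 ^ p.+1) \max_(l < M | l %% 2 ^ p.+1 == s) phi p l.
  by apply: leq_sum.
pose bad p := [exists l : 'I_M, [&& p < h, l == l0 %[mod 2 ^ p.+1] & ~~ fin p l]].
have [ex|nex] := pselect (exists p, bad p); last first.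
  rewrite /total_work -addnS leq_add ?leq_sum //.
  apply: (@ltn_sum_at _ _ (fun l : 'I_M => psi l) (fun l : 'I_M => psi' l) (Ordinal l0M)) => //=.
    by move=> l _; apply: psile.
  apply: psilt => p ph; apply: contrapT => nf; apply: nex; exists p.
  by apply/existsP; exists (Ordinal l0M); rewrite ph eqxx; apply/negP.
(* By minimality of [p], every team in the class of [l0] modulo [2 ^ p.+1] has finished all earlier
   levels, so each unfinished one progresses and the maximum drops. *)
case: (ex_minnP ex) => p /existsP[l1 /and3P[ph l1E nf1]] min.
have finE q (l : 'I_M) : q < p -> l = l0 %[mod 2 ^ p.+1] -> fin q l.
  move=> qp lE; apply: contraT => nf; suff /min : bad q by rewrite leqNgt qp.
  apply/existsP; exists l; rewrite nf andbT.
  rewrite (ltn_trans qp ph) /=.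
  have dv : 2 ^ q.+1 %| 2 ^ p.+1 by rewrite dvdn_exp2l // ltnS ltnW.
  by apply/eqP; rewrite -(modn_dvdm l dv) lE modn_dvdm.
rewrite /total_work -addSn leq_add ?leq_sum //; last by move=> l _; apply: psile.
apply: (@ltn_sum_at _ _
  (fun p : 'I_h => \sum_(s < 2 ^ p.+1) \max_(l < M | l %% 2 ^ p.+1 == s) phi p l)
  (fun p : 'I_h => \sum_(s < 2 ^ p.+1) \max_(l < M | l %% 2 ^ p.+1 == s) phi' p l)
  (Ordinal ph)) => //= [p' _|]; first exact: sumle.
have s_lt : l0 %% 2 ^ p.+1 < 2 ^ p.+1 by rewrite ltn_mod expn_gt0.
apply: (@ltn_sum_at _ _
  (fun s : 'I__ => \max_(l < M | l %% 2 ^ p.+1 == s) phi p l)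
  (fun s : 'I__ => \max_(l < M | l %% 2 ^ p.+1 == s) phi' p l) (Ordinal s_lt)) => //=.
have lt1 : phi' p l1 < phi p l1.
  by apply: philt => //; [exact/eqP | move=> q qp; apply: finE => //; apply/eqP].
have le1 : phi p l1 <= \max_(l < M | l %% 2 ^ p.+1 == l0 %% 2 ^ p.+1) phi p l.
  exact: (@leq_bigmax_cond _ _ (fun l : 'I_M => phi p l)).
case E : (\max_(l < M | _) phi p l) le1 => [|mx] le1; first by lia.
rewrite ltnS; apply/bigmax_leqP => l /eqP lE.
have [f|nf] := boolP (fin p l).
  by have := phile p l (ltn_ord l); rewrite fin0 //; lia.
rewrite -ltnS -E.
apply: (@leq_trans (phi p l)); last first.
  by apply: (@leq_bigmax_cond _ _ (fun l : 'I_M => phi p l)); apply/eqP.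
by apply: philt => // q qp; apply: finE.
Qed.

(* The level at which the leaves [l] and [l'] are separated. *)
Definition meet_level (l l' : nat) := logn 2 ((l - l') + (l' - l)).

Lemma meet_level_ltn (l l' : nat) : M <= 2 ^ h -> l < M -> l' < M -> l != l' ->
  meet_level l l' < h.
Proof.
move=> Mh lM l'M ne; rewrite -(ltn_exp2l _ _ (isT : 1 < 2)).
apply: (@leq_ltn_trans ((l - l') + (l' - l))); last by lia.
apply: dvdn_leq; first by lia.
by rewrite pfactor_dvdn //; lia.
Qed.

Lemma eqn_mod_meet_level (l l' p : nat) : l != l' ->
  (l == l' %[mod 2 ^ p.+1]) = (p < meet_level l l').
Proof.
move=> ne; rewrite /meet_level -pfactor_dvdn //; last by lia.
have [le|lt] := leqP l' l; first by rewrite eqn_mod_dvd //; congr (_ %| _); lia.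
by rewrite eq_sym eqn_mod_dvd 1?ltnW //; congr (_ %| _); lia.
Qed.

(** The leaves separated from [l'] at level [p] form a single class, so each coordinate is paid for
    once per level. *)
Lemma meet_levelP (l l' p : nat) : l != l' -> meet_level l l' = p ->
  l = l' + 2 ^ p %[mod 2 ^ p.+1].
Proof.
move=> ne lv; have x0 : 0 < (l - l') + (l' - l) by lia.
have := pfactor_dvdn p (isT : prime 2) x0; rewrite -/(meet_level l l') lv leqnn.
move=> /dvdnP[y yE].
have := pfactor_dvdn p.+1 (isT : prime 2) x0; rewrite -/(meet_level l l') lv ltnn.
rewrite yE expnS dvdn_pmul2r ?expn_gt0 // dvdn2 => /negbFE oy.
have [w wE] : exists w, y = w.*2.+1 by exists y./2; rewrite -[LHS]odd_double_half oy.
have [le|lt] := leqP l' l.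
  have -> : l = w * 2 ^ p.+1 + (l' + 2 ^ p).
    by rewrite expnS; move: yE; rewrite wE; nia.
  by rewrite -[2 * _]expnS modnMDl.
have <- : w.+1 * 2 ^ p.+1 + l = l' + 2 ^ p.
  by rewrite expnS; move: yE; rewrite wE; nia.
by rewrite -[2 * _]expnS modnMDl.
Qed.

End Charging.

(** * The joint strategy *)

Section Pursuit.
Variables (T : nat -> sgraph) (rt : forall i, rooting (T i)) (R : nat -> nat).
Hypothesis dpt_leq : forall i x, dpt (rt i) x <= R i.
Hypothesis R_gt0 : forall i, 0 < R i.
Variable n : nat.
Hypothesis n_gt0 : 0 < n.

Let M := n.-1./2.+1.
Let h := up_log 2 M.

Definition team_kind l :=
  if l.+1 < M then Ordinary else if odd n then Single else Double.

(** Lexicographic order: meeting level first, then the index, which is below [n]. *)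
Definition rank l i := meet_level l i./2 * n + i.

Definition teams := nat -> pos T * pos T.

Definition next_teams (c : teams) r : teams :=
  fun l => team_next rt n l (team_kind l) (rank l) (c l) r.

Definition teams_inv (c : teams) r :=
  forall l, l < M -> team_inv rt n l (team_kind l) (rank l) (c l).1 (c l).2 r.

Definition level_work (c : teams) r p l :=
  \sum_(i < n | outside l i && (meet_level l i./2 == p))
     work rt R n (outside l) (rank l) (c l).1 r i.

Definition finished (c : teams) r p l :=
  [forall i : 'I_n, outside l i && (meet_level l i./2 == p) ==>
     fixed_below n (outside l) (rank l) (c l).1 r i].

Definition teams_work (c : teams) r :=
  total_work M h (level_work c r)
    (fun l => team_work rt R n l (team_kind l) (c l).1 (c l).2 r).

Definition escaped (c : teams) r :=
  forall l, l < M -> ~ caught_at n (c l).1 r /\ ~ caught_at n (c l).2 r.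

Lemma rank_inj l i j : i < n -> j < n -> rank l i = rank l j -> i = j.
Proof.
move=> i_n jn /(congr1 (modn^~ n)).
by rewrite /rank /= !modnMDl !modn_small.
Qed.

Lemma half_lt i : i < n -> i./2 < M. Proof. rewrite /M; lia. Qed.

Lemma leaf_lt l : l < M -> l.*2 < n. Proof. rewrite /M; lia. Qed.

Lemma leaf_lt1 l : l < M ->
  match team_kind l with Single => n <= l.*2.+1 | _ => l.*2.+1 < n end.
Proof.
rewrite /team_kind /M => lM; case: ifP => lt; first by lia.
by case: (boolP (odd n)) => on; lia.
Qed.

Lemma finishedP c r p l i : finished c r p l -> i < n -> outside l i ->
  meet_level l i./2 = p -> fixed_below n (outside l) (rank l) (c l).1 r i.
Proof.
move=> /forallP f i_n oi lv; have := f (Ordinal i_n).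
by rewrite /= oi lv eqxx.
Qed.

Lemma next_teamsE c r l :
  next_teams c r l = team_next rt n l (team_kind l) (rank l) ((c l).1, (c l).2) r.
Proof. by rewrite /next_teams; case: (c l). Qed.

Lemma next_teams_prio c r l : l < M -> forall i, outside l i ->
  (next_teams c r l).1 i = prio_move rt n (outside l) (rank l) (c l).1 r i.
Proof.
by move=> lM i oi; rewrite next_teamsE; apply: (team_prio _ _ (leaf_lt lM) (leaf_lt1 lM)).
Qed.

Lemma teams_round c r r' :
    teams_inv c r -> pos_step n r r' -> in_play rt n r -> in_play rt n r' ->
    escaped c r -> escaped c r' -> escaped (next_teams c r') r' ->
  teams_inv (next_teams c r') r' /\
  teams_work (next_teams c r') r' < teams_work c r.
Proof.
move=> inv rr' ir ir' er er' en.
have tr l (lM : l < M) := team_round dpt_leq (@rank_inj l) (leaf_lt lM) (leaf_lt1 lM)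
  (inv l lM) rr' ir ir' (er l lM).1 (er l lM).2 (er' l lM).1 (er' l lM).2.
have {}tr l (lM : l < M) : team_inv rt n l (team_kind l) (rank l)
      (next_teams c r' l).1 (next_teams c r' l).2 r' /\
    team_work rt R n l (team_kind l) (next_teams c r' l).1 (next_teams c r' l).2 r'
     + (~~ dirty n l (c l).1 r && ([exists i : 'I_n, ~~ outside l i && (r' i != r i)]
       || `[< r' = r >] && if team_kind l is Ordinary then false else true))
    <= team_work rt R n l (team_kind l) (c l).1 (c l).2 r.
  have [e1 e2] := en l lM.
  by case: (tr l lM); rewrite -next_teamsE.
split; first by move=> l lM; have [] := tr l lM.
have pr l (lM : l < M) := prio_round dpt_leq (@rank_inj l)
  (let: And4 pi _ _ _ := inv l lM in pi) rr' (next_teams_prio c r' lM).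
(* A pass is charged to the last leaf, whose team is never [Ordinary] and so progresses on passes
   too. *)
have [l0 [l0M movedE moved]] : exists l0, [/\ l0 < M,
    forall i, r' i != r i -> i./2 = l0 &
    (exists2 i : 'I_n, i./2 = l0 & r' i != r i) \/ (r' = r /\ l0 = M.-1)].
  case: rr' => [->|[i [i_n a out]]].
    by exists M.-1; split=> // [i|]; [rewrite eqxx | right].
  exists i./2; split; first exact: half_lt.
    by move=> j; have [->//|/out->] := eqVneq j i; rewrite eqxx.
  left; exists (Ordinal i_n) => //=.
  by apply/eqP => e; rewrite e adj_irr in a.
apply: (@total_work_decr _ _ _ _ _ _ (finished c r) l0 l0M).
- move=> p l lM; apply: leq_sum => i /andP[oi _].
  by have [_ + _] := pr l lM; apply.
- by move=> l lM; have [_] := tr l lM; apply: leq_trans; rewrite leq_addr.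
- move=> p l fin; rewrite /level_work big1 // => i /andP[oi /eqP lv].
  by rewrite /work (finishedP fin).
- move=> p l ph lM lE finq nfin; have [_ _ pr2] := pr l lM.
  have [i [i_n oi lv nfb]] : exists i, [/\ i < n, outside l i, meet_level l i./2 = p
     & ~~ fixed_below n (outside l) (rank l) (c l).1 r i].
    have [i] := existsP nfin; rewrite negb_imply => /andP[/andP[oi /eqP lv] nfb].
    by exists i.
  have [|||j [jn oj /eqP lvj lt]] := pr2 (fun i => meet_level l i./2 == p).
  (* The moved coordinate meets [l] deeper than level [p], so it ranks after the unsettled [i] and
     is unsettled as well. *)
  + move=> j oj rj; apply: contra nfb; apply: fixed_below_leq.
    have jl0 := movedE j rj; have: p < meet_level l j./2.
      by rewrite -eqn_mod_meet_level ?jl0 ?lE // -jl0 eq_sym.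
    by rewrite /rank lv; nia.
  + by exists i; rewrite lv eqxx.
  + move=> j jn oj nfj; have [lt|gt|e] := ltngtP (meet_level l j./2) p; last by left; apply/eqP.
      by case/negP: nfj; apply: (finishedP (finq _ lt)).
    by right=> j' j'n _ /eqP; rewrite /rank => ->; nia.
  + apply: (@ltn_sum_at _ _
      (fun i : 'I_n => work rt R n (outside l) (rank l) (c l).1 r i)
      (fun i : 'I_n => work rt R n (outside l) (rank l) (next_teams c r' l).1 r' i)
      (Ordinal jn)) => //=; first by rewrite oj lvj eqxx.
    by move=> k /andP[ok _]; have [_ + _] := pr l lM; apply.
- move=> fin; have [_] := tr l0 l0M; apply: leq_trans.
  rewrite -addn1 leq_add2l lt0b; apply/andP; split.
    apply/dirtyPn => i; apply/negP => /and3P[i_n oi]; apply/negP; rewrite negbK.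
    have lt := meet_level_ltn (up_logP M (isT : 1 < 2)) l0M (half_lt i_n) _.
    rewrite eq_sym in lt; have fb := finishedP (fin _ (lt oi)) i_n oi erefl.
    by rewrite (fixed_below_mismatch fb) ?eqxx.
  apply/orP; case: moved => [[i il ri]|[-> ->]]; [left|right].
    by apply/existsP; exists i; rewrite /outside il eqxx.
  by rewrite asboolT //= /team_kind ltnn; case: (odd n).
Qed.

Definition centers : teams := fun _ => (center rt, center rt).

Lemma teams_inv_center r : in_play rt n r -> teams_inv centers r.
Proof.
move=> ir l lM; split=> //=; first by move=> i _ _; split=> //; apply: anc_root.
case: ifP => // _; apply: leaf_inv_root => ks; apply: ir.
by have := leaf_lt1 lM; rewrite ks.
Qed.

Let slack l := if team_kind l is Single then 1 else 2.

Lemma teams_work_ge c r : teams_inv c r -> escaped c r ->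
  \sum_(l < M) slack l <= teams_work c r.
Proof.
move=> inv esc; apply: leq_trans (leq_addl _ _); apply: leq_sum => l _.
have [nB nF] := esc l (ltn_ord l).
exact: (team_work_ge dpt_leq (leaf_lt (ltn_ord l)) (leaf_lt1 (ltn_ord l)) (inv l (ltn_ord l))).
Qed.

Lemma teams_work_center r :
  teams_work centers r + M <= h.+1 * (\sum_(i < n) R i) + \sum_(l < M) slack l.
Proof.
rewrite mulSn [_ + h * _]addnC /teams_work /total_work -!addnA; apply: leq_add.
  apply: (@leq_trans (\sum_(p < h) \sum_(i < n) R i)); last first.
    by rewrite sum_nat_const card_ord.
  apply: leq_sum => p _.
  have rs (i : 'I_n) : (i./2 + 2 ^ p) %% 2 ^ p.+1 < 2 ^ p.+1 by rewrite ltn_mod expn_gt0.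
  (* At level [p], coordinate [i] is corrected only by teams in the class of [i./2 + 2 ^ p]. *)
  rewrite [leqRHS](partition_big (fun i : 'I_n => Ordinal (rs i)) xpredT) //=.
  apply: leq_sum => s _; apply/bigmax_leqP => l /eqP ls.
  rewrite /level_work [leqLHS]big_mkcond [leqRHS]big_mkcond; apply: leq_sum => i _.
  case: ifP => // /andP[oi /eqP lv].
  have -> : Ordinal (rs i) == s.
    apply/eqP/val_inj; rewrite /= -ls; apply/esym/(meet_levelP _ lv).
    by rewrite eq_sym.
  by rewrite /work; case: ifP => // _; apply: leq_subr.
have -> : \sum_(i < n) R i = \sum_(l < M) \sum_(i < n | i./2 == l) R i.
  by rewrite (partition_big (fun i : 'I_n => Ordinal (half_lt (ltn_ord i))) xpredT).
apply: (@leq_trans (\sum_(l < M)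
    (team_work rt R n l (team_kind l) (center rt) (center rt) r + 1))).
  by rewrite big_split sum_nat_const card_ord muln1.
rewrite -big_split /=; apply: leq_sum => l _.
have lM := ltn_ord l; have ln := leaf_lt lM.
rewrite (bigD1 (Ordinal ln)) /=; last by rewrite doubleK.
have tw : team_work rt R n l (team_kind l) (center rt) (center rt) r <=
    work0 (team_kind l) (R l.*2) (R l.*2.+1).
  rewrite /team_work; case: ifP => // _.
  by rewrite /leaf_work /center !dpt_root depth_work_root.
apply: leq_trans (leq_add tw (leqnn 1)) _.
have two : l.*2.+1 < n ->
    R l.*2.+1 <= \sum_(i < n | (i./2 == l) && (i != Ordinal ln)) R i.
  move=> l1; rewrite (bigD1 (Ordinal l1)) /= ?leq_addr //.
  by rewrite -(inj_eq val_inj) /= uphalf_double eqxx; lia.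
move: (leaf_lt1 lM); rewrite /work0 /slack.
by case: (team_kind l) => [/two|_|/two]; move: (\sum_(i < n | _) _) => x; lia.
Qed.

End Pursuit.

(** * The strategy as a function of the robber's past *)

Section Strategy.
Variables (T : nat -> sgraph) (rt : forall i, rooting (T i)) (R : nat -> nat).
Hypothesis dpt_leq : forall i x, dpt (rt i) x <= R i.
Hypothesis R_gt0 : forall i, 0 < R i.
Variable m : nat.
Let n := m.+1.
Let M := m./2.+1.
Let G := cart_upto T m.

Definition play_teams (s : seq G) : teams T :=
  foldl (fun c v => next_teams rt n c (pos_of rt v)) (centers rt) s.

(* The last cop is the front cop of the last team, which matters only for    *)
(* even [n]: for odd [n] the index is at most [m./2]. *)
Definition team_strategy : strategy G n./2.+1 := fun s i =>
  of_pos m (if i < M then (play_teams s i).1 else (play_teams s M.-1).2).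

Lemma play_teamsS (r : nat -> G) t : play_teams (mkseq r t.+1) =
  next_teams rt n (play_teams (mkseq r t)) (pos_of rt (r t)).
Proof.
by rewrite /play_teams /mkseq -addn1 iotaD map_cat foldl_cat.
Qed.

Lemma team_strategy_legal : legal team_strategy.
Proof.
move=> r _ t i; apply: of_pos_step; rewrite play_teamsS !next_teamsE.
case: ifP => [iM|_].
  by apply: (team_next_legal rt (rank n i) _ _ _ _ _).1; [apply: leaf_lt | apply: leaf_lt1].
by apply: (team_next_legal rt (rank n M.-1) _ _ _ _ _).2; [apply: leaf_lt | apply: leaf_lt1].
Qed.

Lemma pos_of_in_play (x : G) : in_play rt n (pos_of rt x).
Proof. by move=> i; apply: pos_of_center. Qed.

Lemma caught_at_of_pos B (x : G) : caught_at n B (pos_of rt x) -> of_pos m B = x.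
Proof.
by move=> e; rewrite -[RHS](pos_ofK rt); apply: eq_of_pos => i im; apply: e.
Qed.

Lemma play_teams_single (s : seq G) l :
  team_kind n l <> Double -> (play_teams s l).2 = (play_teams s l).1.
Proof.
move=> nd; elim/last_ind: s => [//|s v IH].
rewrite /play_teams foldl_rcons -/(play_teams s) next_teamsE IH /team_next /=.
case: first_mismatchP => //= _; rewrite /leaf_rule.
by case: (team_kind n l) nd.
Qed.

Lemma escaped_play (s : seq G) (x : G) :
  (forall i, team_strategy s i != x) -> escaped n (play_teams s) (pos_of rt x).
Proof.
move=> nx l lM; have lk : l < n./2.+1 by move: lM; rewrite /n /=; lia.
have nB : ~ caught_at n (play_teams s l).1 (pos_of rt x).
  move=> /caught_at_of_pos e; have /eqP[] := nx (Ordinal lk).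
  by rewrite /team_strategy /= lM.
split=> //.
have [/play_teams_single -> //|dbl] := pselect (team_kind n l <> Double).
have {}dbl : team_kind n l = Double by apply: contrapT.
have [lE on] : l = M.-1 /\ ~~ odd n.
  move: dbl; rewrite /team_kind; case: ifP => // lt; case: ifP => // /negbT on _.
  by move: lt lM; rewrite /M /n /=; split=> //; lia.
have Mk : M < n./2.+1 by move: on; rewrite /M /n /=; lia.
move=> /caught_at_of_pos e; have /eqP[] := nx (Ordinal Mk).
by rewrite /team_strategy ltnn -[M.-1]lE.
Qed.

Lemma team_strategy_winning :
  winning_within team_strategy ((up_log 2 M).+1 * (\sum_(i < n) R i) - M).+1.
Proof.
split=> [|r wr]; first exact: team_strategy_legal.
set N := _.+1; apply: contrapT => nc.
have free s : s <= N -> forall i, team_strategy (mkseq r s) i != r s /\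
    team_strategy (mkseq r s) i != r s.-1.
  move=> sN i; split; apply/eqP => e; apply: nc; exists s => //; exists i.
    by left.
  by case: s sN e => [|s] sN e; [left | right].
pose C t := play_teams (mkseq r t); pose rho t := pos_of rt (r t).
(* At time 0 the predecessor is [rho 0] itself: the choice of the starting vertex counts as a
   pass. *)
have step_rho t : pos_step n (rho t.-1) (rho t).
  by case: t => [|t]; [left | apply: pos_of_step].
have inv t : t <= N -> teams_inv rt n (C t) (rho t.-1) /\
    teams_work rt R n (C t) (rho t.-1) + t <= teams_work rt R n (centers rt) (rho 0).
  elim: t => [|t IH] tN.
    by split; [apply: teams_inv_center (pos_of_in_play _) | rewrite addn0].
  have [it wt] := IH (ltnW tN).
  have esc1 : escaped n (C t) (rho t.-1).
    by apply: escaped_play => i; have [] := free t (ltnW tN) i.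
  have esc2 : escaped n (C t) (rho t).
    by apply: escaped_play => i; have [] := free t (ltnW tN) i.
  have esc3 : escaped n (C t.+1) (rho t).
    by apply: escaped_play => i; have [] := free t.+1 tN i.
  have CS : C t.+1 = next_teams rt n (C t) (rho t) by apply: play_teamsS.
  rewrite CS in esc3 *.
  have [it' lt] := teams_round dpt_leq (ltn0Sn m) it (step_rho t)
    (@pos_of_in_play _) (@pos_of_in_play _) esc1 esc2 esc3.
  split; first exact: it'.
  by apply: leq_trans wt; rewrite addnS -addSn leq_add2r.
have [iN wN] := inv N (leqnn N).
have escN : escaped n (C N) (rho N.-1).
  by apply: escaped_play => i; have [] := free N (leqnn N) i.
have arith S W W0 B : W + N <= W0 -> W0 + M <= B + S -> S <= W -> N + M <= B.
  by clear; lia.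
have := arith _ _ _ _ wN (teams_work_center rt R (ltn0Sn m) (rho 0))
  (teams_work_ge dpt_leq R_gt0 (ltn0Sn m) iN escN).
rewrite /N [_.-1]/= -/M; move: (_ * _) => B; clear; lia.
Qed.

End Strategy.

(** * The bound *)

Lemma eq_cart_upto (T T' : nat -> sgraph) m :
  (forall i, i <= m -> T i = T' i) -> cart_upto T m = cart_upto T' m.
Proof.
elim: m => [|m IH] eqT /=; first exact: eqT.
by rewrite IH ?eqT // => i im; apply: eqT; apply: leqW.
Qed.

Lemma radius_gt0 (G : sgraph) (rt : rooting G) :
  1 < #|G| -> (forall x, dpt rt x <= radius G) -> 0 < radius G.
Proof.
rewrite (cardD1 (rt_root rt)) inE ltnS => /card_gt0P[x].
rewrite !inE andbT -(dpt_eq0 rt) -lt0n => x0 le.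
exact: leq_trans (le x).
Qed.

(** [capt] is taken over strategies with exactly [cop_number] cops, so the cop number has to be
    determined first. *)
Lemma capt_upper (T : nat -> sgraph) m :
    (forall i, is_tree (T i)) -> (forall i, 1 < #|T i|) ->
  capt (cart_upto T m) <=
    ((up_log 2 m./2.+1).+1 * (\sum_(i < m.+1) radius (T i)) - m./2.+1).+1.
Proof.
move=> treeT T2; pose R i := radius (T i).
have rtP i := cid (tree_rooting (treeT i)).
pose rt i := projT1 (rtP i).
have dpt_leq i x : dpt (rt i) x <= R i := projT2 (rtP i) x.
have R_gt0 i : 0 < R i := radius_gt0 (T2 i) (@dpt_leq i).
have nbr i (x : T i) : exists y, adj x y := ex_adj x (treeT i).1 (T2 i).
have ww := @team_strategy_winning T rt R dpt_leq R_gt0 m.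
have cn : cop_number (cart_upto T m) = m.+1./2.+1.
  apply/eqP; rewrite eqn_leq (cop_number_lower rt nbr _ T2) andbT.
  rewrite /cop_number; case: ex_minnP => k _; apply; apply/asboolP.
  exists (team_strategy rt (m := m)); case: ww => leg win; split=> // r /win[s _ cs].
  by exists s.
rewrite /capt; case: ex_minnP => t _; apply; apply/asboolP.
by rewrite cn; exists (team_strategy rt (m := m)).
Qed.

Local Open Scope ring_scope.

(* n = 1 needs [single] because capt(T 0) = radius (T 0), while the bound is *)
(* then 1, as ceil(log_2 1) = 0.                                             *)
Theorem theorem2p2 (n : nat) (T : nat -> sgraph)
    (n_gt0 : (0 < n)%N)
    (treeT : forall i, (i < n)%N -> is_tree (T i))
    (nontrivT : forall i, (i < n)%N -> (1 < #|T i|)%N)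
    (single : n = 1%N -> (radius (T 0%N) <= 1)%N) :
  (capt (cart_upto T n.-1))%:Z <=
    (\sum_(i < n) radius (T i))%N%:Z * (up_log 2 n)%:Z - (n.-1 %/ 2)%N%:Z + 1.
Proof.
case: n n_gt0 treeT nontrivT single => // m _ treeT nontrivT single.
(* The factors past [n] are replaced by [T 0], as the strategy is built for trees at all indices. *)
pose T' i := if (i <= m)%N then T i else T 0%N.
have T'E i : (i <= m)%N -> T i = T' i by rewrite /T' => ->.
have treeT' i : is_tree (T' i) by rewrite /T'; case: ifP => im; apply: treeT.
have nontrivT' i : (1 < #|T' i|)%N by rewrite /T'; case: ifP => im; apply: nontrivT.
have := capt_upper m treeT' nontrivT'.
rewrite -(eq_cart_upto T'E).
have -> : (\sum_(i < m.+1) radius (T' i) = \sum_(i < m.+1) radius (T i))%N.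
  by apply: eq_bigr => i _; rewrite -T'E // -ltnS.
(* Nontrivial trees have positive radius; this keeps the subtraction in [capt_upper] from
   truncating. *)
have rad_ge : (m.+1 <= \sum_(i < m.+1) radius (T i))%N.
  rewrite -[leqLHS](card_ord m.+1) -sum1_card; apply: leq_sum => i _.
  have [rt] := tree_rooting (treeT i (ltn_ord i)).
  exact: radius_gt0 (nontrivT i (ltn_ord i)).
rewrite [m.+1.-1]/= divn2.
clear T' T'E treeT treeT' nontrivT nontrivT'.
case: m => [|m] in single rad_ge *.
  rewrite big_ord1 /= up_log1 => le; have := single erefl; lia.
(* The ceiling of log2 n is one more than that of log2 of the number of leaves: the levels plus the
   endgame. The bound obtained here is one round better than the claim. *)
rewrite [up_log 2 m.+2]up_log2S //; move: rad_ge; set S := (\sum_(i < m.+2) radius (T i))%N.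
move: S (up_log 2 _) (capt _) => S h c rad_ge le.
have : (m.+2 <= h.+1 * S)%N by nia.
by move: le; rewrite -PoszM [(S * _)%N]mulnC; move: (h.+1 * S)%N => B; clear; lia.
Qed.
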